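(* Over the dependent type theory $\mathcal{H}$, for a type $A$ and a dependent type $x:A\vdash B(x):\mathsf{type}$ with associated polynomial functor $P$, the rules for homotopical W-types (formation, introduction, elimination and propositional computation) for $A,B$ are equivalent to the existence of a homotopy-initial $P$-algebra. (Precisely: if the rules hold, then $(W,s_W)$ with $W=(\mathsf{W}x:A)B(x)$ and $s_W(\mathsf{pair}(a,t))=\mathsf{sup}(a,t)$ is a homotopy-initial $P$-algebra; conversely, if $(W,s_W)$ is a homotopy-initial $P$-algebra, then taking $(\mathsf{W}x:A)B(x):=W$ and $\mathsf{sup}(a,t):=s_W(\mathsf{pair}(a,t))$, the elimination and propositional computation rules are derivable.)
   Context: $\mathcal{H}$ is the intensional Martin-Löf dependent type theory with judgements $A:\mathsf{type}$, $A=B:\mathsf{type}$, $a:A$, $a=b:A$ (definitional equality), having: intensional identity types $\mathsf{Id}_A(a,b)$ with $\mathsf{refl}$ and the usual elimination and definitional computation rule; $\Sigma$-types (pairing, projections $\pi_1,\pi_2$); $\Pi$-types ($A\to B$ the non-dependent case); the propositional $\eta$-rule for $\Pi$-types (for every $f:(\Pi x:A)B(x)$ the type $\mathsf{Id}(f,\lambda x.f(x))$ is inhabited); and function extensionality: for all $f,g:A\to B$ the type $(\Pi x:A)\mathsf{Id}_B(f x,g x)\to \mathsf{Id}_{A\to B}(f,g)$ is inhabited. No definitional $\eta$-rules, no identity reflection, no K/UIP. The polynomial functor of $x:A\vdash B(x)$ is $PX := (\Sigma x:A)(B(x)\to X)$, with action on $f:C\to D$ given by $Pf(\mathsf{pair}(x,v))=\mathsf{pair}(x,f\circ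 v)$. A $P$-algebra is a pair $(C,s_C)$ with $s_C:PC\to C$. The type of weak homomorphisms is $P\text{-}\mathsf{Alg}[(C,s_C),(D,s_D)] := (\Sigma f:C\to D)\,\mathsf{Id}_{PC\to D}(f\circ s_C,\ s_D\circ Pf)$. A type $X$ is contractible if $(\Sigma x:X)(\Pi y:X)\mathsf{Id}_X(x,y)$ is inhabited. A $P$-algebra $(C,s_C)$ is homotopy-initial if for every $P$-algebra $(D,s_D)$ the type $P\text{-}\mathsf{Alg}[(C,s_C),(D,s_D)]$ is contractible. Rules for homotopical W-types (writing $W$ for $(\mathsf{W}x:A)B(x)$): formation: $(\mathsf{W}x:A)B(x):\mathsf{type}$. Introduction: for $a:A$, $t:B(a)\to W$, $\mathsf{sup}(a,t):W$. Elimination: given $w:W\vdash C(w):\mathsf{type}$ and $x:A,\ u:B(x)\to W,\ v:(\Pi y:B(x))C(u(y))\vdash c(x,u,v):C(\mathsf{sup}(x,u))$, one has $w:W\vdash \mathsf{wrec}(w,c):C(w)$. Propositional computation: under the same premisses, $x:A,\ u:B(x)\to W\vdash \mathsf{wcomp}(x,u,c):\mathsf{Id}\big(\mathsf{wrec}(\mathsf{sup}(x,u),c),\ c(x,u,\lambda y.\mathsf{wrec}(u(y),c))\big)$. *)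

(* Defs.v *)
(* Plain Rocq with the Stdlib.  The type theory H is deeply embedded: raw
   de Bruijn syntax and an inductive derivability predicate, so that H has
   exactly the listed rules and inherits nothing (definitional eta, universes,
   inductive types, axioms) from the ambient Rocq. *)
From Stdlib Require Export List.
Export ListNotations.

(** * Raw syntax *)

(* Types and terms share one raw syntax.
   [con f] and [bapp k e a] are not touched by any rule of H: they are the
   symbols available to extensions of H (base types, dependent base types,
   constants, further type and term formers).  [bapp k e a] applies the
   symbol expression [e] to one more argument [a], in which [k] variables are
   bound; e.g. a dependent base type x : X |- Y(x) is [bapp 0 (con n) (var 0)]
   in a context with head X. *)
Inductive tm : Type :=
| var (n : nat)
| con (f : nat)
| bapp (k : nat) (e a : tm)
| Id (A a b : tm)
| refl (a : tm)
| J (a b p d : tm)          (* binds one variable in [d] *)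
| Sig (A B : tm)            (* binds one variable in [B] *)
| tpair (a b : tm)
| tsplit (e d : tm)         (* binds two variables in [d] *)
| Pi (A B : tm)             (* binds one variable in [B] *)
| lam (b : tm)
| tapp (f a : tm)
| eta (f : tm)              (* witness of the propositional eta-rule *)
| funext (f g : tm).        (* witness of function extensionality *)

Definition upr (r : nat -> nat) : nat -> nat :=
  fun n => match n with 0 => 0 | S m => S (r m) end.

Fixpoint ren (r : nat -> nat) (t : tm) : tm :=
  match t with
  | var n => var (r n)
  | con f => con f
  | bapp k e a => bapp k (ren r e) (ren (Nat.iter k upr r) a)
  | Id A a b => Id (ren r A) (ren r a) (ren r b)
  | refl a => refl (ren r a)
  | J a b p d => J (ren r a) (ren r b) (ren r p) (ren (upr r) d)
  | Sig A B => Sig (ren r A) (ren (upr r) B)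
  | tpair a b => tpair (ren r a) (ren r b)
  | tsplit e d => tsplit (ren r e) (ren (upr (upr r)) d)
  | Pi A B => Pi (ren r A) (ren (upr r) B)
  | lam b => lam (ren (upr r) b)
  | tapp f a => tapp (ren r f) (ren r a)
  | eta f => eta (ren r f)
  | funext f g => funext (ren r f) (ren r g)
  end.

Definition scons (t : tm) (s : nat -> tm) : nat -> tm :=
  fun n => match n with 0 => t | S m => s m end.
Notation "t .: s" := (scons t s) (at level 55, right associativity).

(* [shift k] is the weakening by the [k] most recent variables;
   [shift 0] is the identity substitution. *)
Definition shift (k : nat) : nat -> tm := fun n => var (k + n).

Definition up (s : nat -> tm) : nat -> tm := var 0 .: (fun n => ren S (s n)).

Fixpoint subst (s : nat -> tm) (t : tm) : tm :=
  match t with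
  | var n => s n
  | con f => con f
  | bapp k e a => bapp k (subst s e) (subst (Nat.iter k up s) a)
  | Id A a b => Id (subst s A) (subst s a) (subst s b)
  | refl a => refl (subst s a)
  | J a b p d => J (subst s a) (subst s b) (subst s p) (subst (up s) d)
  | Sig A B => Sig (subst s A) (subst (up s) B)
  | tpair a b => tpair (subst s a) (subst s b)
  | tsplit e d => tsplit (subst s e) (subst (up (up s)) d)
  | Pi A B => Pi (subst s A) (subst (up s) B)
  | lam b => lam (subst (up s) b)
  | tapp f a => tapp (subst s f) (subst s a)
  | eta f => eta (subst s f)
  | funext f g => funext (subst s f) (subst s g)
  end.
Notation "t .[ s ]" := (subst s t)
  (at level 2, s at level 200, left associativity, format "t .[ s ]").

Definition arr (A B : tm) : tm := Pi A B.[shift 1].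

Definition comp (g f : tm) : tm :=
  lam (tapp g.[shift 1] (tapp f.[shift 1] (var 0))).

(** * The theory H and its extensions *)

(* Contexts list the most recent variable first. *)
Definition ctx := list tm.

Inductive judgement : Type :=
| IsCtx
| IsType (A : tm)
| EqType (A B : tm)
| HasType (a A : tm)
| EqTerm (a b A : tm).

Definition jsubst (s : nat -> tm) (j : judgement) : judgement :=
  match j with
  | IsCtx => IsCtx
  | IsType A => IsType A.[s]
  | EqType A B => EqType A.[s] B.[s]
  | HasType a A => HasType a.[s] A.[s]
  | EqTerm a b A => EqTerm a.[s] b.[s] A.[s]
  end.

(* Derivability in the extension of H by the judgements in [ax]; since [ax] may
   contain all judgements derivable in a larger theory, this covers every
   extension of H by further rules.  H has no closed base type, so [ax] is where
   the types A, B(x), or rules such as those for W-types, come from.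
   Substitution is a structural rule because [ax] is arbitrary. *)
Reserved Notation "G |-{ ax } j" (at level 70, ax at level 200, no associativity).

Inductive der (ax : ctx -> judgement -> Prop) : ctx -> judgement -> Prop :=
(* contexts and axioms *)
| d_nil : [] |-{ax} IsCtx
| d_cons G A : G |-{ax} IsType A -> A :: G |-{ax} IsCtx
| d_ax G j : ax G j -> G |-{ax} IsCtx -> G |-{ax} j
| d_var G n A :
    G |-{ax} IsCtx -> nth_error G n = Some A ->
    G |-{ax} HasType (var n) A.[shift (S n)]
(* substitution *)
| d_subst G D s j :
    G |-{ax} j -> D |-{ax} IsCtx ->
    (forall n A, nth_error G n = Some A ->
       D |-{ax} HasType (s n) A.[shift (S n)].[s]) ->
    D |-{ax} jsubst s j
| d_subst_eqtype G D s t A :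
    G |-{ax} IsType A -> D |-{ax} IsCtx ->
    (forall n X, nth_error G n = Some X ->
       D |-{ax} HasType (s n) X.[shift (S n)].[s]) ->
    (forall n X, nth_error G n = Some X ->
       D |-{ax} HasType (t n) X.[shift (S n)].[t]) ->
    (forall n X, nth_error G n = Some X ->
       D |-{ax} EqTerm (s n) (t n) X.[shift (S n)].[s]) ->
    D |-{ax} EqType A.[s] A.[t]
| d_subst_eqterm G D s t a A :
    G |-{ax} HasType a A -> D |-{ax} IsCtx ->
    (forall n X, nth_error G n = Some X ->
       D |-{ax} HasType (s n) X.[shift (S n)].[s]) ->
    (forall n X, nth_error G n = Some X ->
       D |-{ax} HasType (t n) X.[shift (S n)].[t]) ->
    (forall n X, nth_error G n = Some X ->
       D |-{ax} EqTerm (s n) (t n) X.[shift (S n)].[s]) ->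
    D |-{ax} EqTerm a.[s] a.[t] A.[s]
(* definitional equality *)
| d_type_refl G A : G |-{ax} IsType A -> G |-{ax} EqType A A
| d_type_sym G A B : G |-{ax} EqType A B -> G |-{ax} EqType B A
| d_type_trans G A B C :
    G |-{ax} EqType A B -> G |-{ax} EqType B C -> G |-{ax} EqType A C
| d_term_refl G a A : G |-{ax} HasType a A -> G |-{ax} EqTerm a a A
| d_term_sym G a b A : G |-{ax} EqTerm a b A -> G |-{ax} EqTerm b a A
| d_term_trans G a b c A :
    G |-{ax} EqTerm a b A -> G |-{ax} EqTerm b c A -> G |-{ax} EqTerm a c A
| d_conv G a A B :
    G |-{ax} HasType a A -> G |-{ax} EqType A B -> G |-{ax} HasType a B
| d_conv_eq G a b A B :
    G |-{ax} EqTerm a b A -> G |-{ax} EqType A B -> G |-{ax} EqTerm a b B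
(* identity types *)
| d_Id G A a b :
    G |-{ax} IsType A -> G |-{ax} HasType a A -> G |-{ax} HasType b A ->
    G |-{ax} IsType (Id A a b)
| d_Id_cong G A A' a a' b b' :
    G |-{ax} EqType A A' -> G |-{ax} EqTerm a a' A ->
    G |-{ax} EqTerm b b' A ->
    G |-{ax} EqType (Id A a b) (Id A' a' b')
| d_refl G A a :
    G |-{ax} HasType a A -> G |-{ax} HasType (refl a) (Id A a a)
| d_refl_cong G A a a' :
    G |-{ax} EqTerm a a' A ->
    G |-{ax} EqTerm (refl a) (refl a') (Id A a a)
| d_J G A E a b p d :
    Id A.[shift 2] (var 1) (var 0) :: A.[shift 1] :: A :: G |-{ax} IsType E ->
    A :: G |-{ax} HasType d E.[refl (var 0) .: var 0 .: var 0 .: shift 1] ->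
    G |-{ax} HasType a A -> G |-{ax} HasType b A ->
    G |-{ax} HasType p (Id A a b) ->
    G |-{ax} HasType (J a b p d) E.[p .: b .: a .: shift 0]
| d_J_cong G A E a a' b b' p p' d d' :
    Id A.[shift 2] (var 1) (var 0) :: A.[shift 1] :: A :: G |-{ax} IsType E ->
    A :: G |-{ax} EqTerm d d' E.[refl (var 0) .: var 0 .: var 0 .: shift 1] ->
    G |-{ax} EqTerm a a' A -> G |-{ax} EqTerm b b' A ->
    G |-{ax} EqTerm p p' (Id A a b) ->
    G |-{ax} EqTerm (J a b p d) (J a' b' p' d') E.[p .: b .: a .: shift 0]
| d_J_beta G A E a d :
    Id A.[shift 2] (var 1) (var 0) :: A.[shift 1] :: A :: G |-{ax} IsType E ->
    A :: G |-{ax} HasType d E.[refl (var 0) .: var 0 .: var 0 .: shift 1] ->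
    G |-{ax} HasType a A ->
    G |-{ax} EqTerm (J a a (refl a) d) d.[a .: shift 0]
                     E.[refl a .: a .: a .: shift 0]
(* Sigma-types; the projections are the usual instances of [tsplit] *)
| d_Sig G A B :
    G |-{ax} IsType A -> A :: G |-{ax} IsType B ->
    G |-{ax} IsType (Sig A B)
| d_Sig_cong G A A' B B' :
    G |-{ax} EqType A A' -> A :: G |-{ax} EqType B B' ->
    G |-{ax} EqType (Sig A B) (Sig A' B')
| d_pair G A B a b :
    A :: G |-{ax} IsType B ->
    G |-{ax} HasType a A -> G |-{ax} HasType b B.[a .: shift 0] ->
    G |-{ax} HasType (tpair a b) (Sig A B)
| d_pair_cong G A B a a' b b' :
    A :: G |-{ax} IsType B ->
    G |-{ax} EqTerm a a' A -> G |-{ax} EqTerm b b' B.[a .: shift 0] ->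
    G |-{ax} EqTerm (tpair a b) (tpair a' b') (Sig A B)
| d_split G A B C e d :
    Sig A B :: G |-{ax} IsType C ->
    B :: A :: G |-{ax} HasType d C.[tpair (var 1) (var 0) .: shift 2] ->
    G |-{ax} HasType e (Sig A B) ->
    G |-{ax} HasType (tsplit e d) C.[e .: shift 0]
| d_split_cong G A B C e e' d d' :
    Sig A B :: G |-{ax} IsType C ->
    B :: A :: G |-{ax} EqTerm d d' C.[tpair (var 1) (var 0) .: shift 2] ->
    G |-{ax} EqTerm e e' (Sig A B) ->
    G |-{ax} EqTerm (tsplit e d) (tsplit e' d') C.[e .: shift 0]
| d_split_beta G A B C a b d :
    Sig A B :: G |-{ax} IsType C ->
    B :: A :: G |-{ax} HasType d C.[tpair (var 1) (var 0) .: shift 2] ->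
    G |-{ax} HasType a A -> G |-{ax} HasType b B.[a .: shift 0] ->
    G |-{ax} EqTerm (tsplit (tpair a b) d) d.[b .: a .: shift 0]
                     C.[tpair a b .: shift 0]
(* Pi-types *)
| d_Pi G A B :
    G |-{ax} IsType A -> A :: G |-{ax} IsType B ->
    G |-{ax} IsType (Pi A B)
| d_Pi_cong G A A' B B' :
    G |-{ax} EqType A A' -> A :: G |-{ax} EqType B B' ->
    G |-{ax} EqType (Pi A B) (Pi A' B')
| d_lam G A B b :
    G |-{ax} IsType A -> A :: G |-{ax} HasType b B ->
    G |-{ax} HasType (lam b) (Pi A B)
| d_lam_cong G A B b b' :
    G |-{ax} IsType A -> A :: G |-{ax} EqTerm b b' B ->
    G |-{ax} EqTerm (lam b) (lam b') (Pi A B)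
| d_app G A B f a :
    G |-{ax} HasType f (Pi A B) -> G |-{ax} HasType a A ->
    G |-{ax} HasType (tapp f a) B.[a .: shift 0]
| d_app_cong G A B f f' a a' :
    G |-{ax} EqTerm f f' (Pi A B) -> G |-{ax} EqTerm a a' A ->
    G |-{ax} EqTerm (tapp f a) (tapp f' a') B.[a .: shift 0]
| d_beta G A B b a :
    A :: G |-{ax} HasType b B -> G |-{ax} HasType a A ->
    G |-{ax} EqTerm (tapp (lam b) a) b.[a .: shift 0] B.[a .: shift 0]
(* propositional eta and function extensionality *)
| d_eta G A B f :
    G |-{ax} IsType A -> A :: G |-{ax} IsType B ->
    G |-{ax} HasType f (Pi A B) ->
    G |-{ax} HasType (eta f) (Id (Pi A B) f (lam (tapp f.[shift 1] (var 0))))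
| d_funext G A B f g :
    G |-{ax} IsType A -> G |-{ax} IsType B ->
    G |-{ax} HasType f (arr A B) -> G |-{ax} HasType g (arr A B) ->
    G |-{ax} HasType (funext f g)
      (arr (Pi A (Id B.[shift 1] (tapp f.[shift 1] (var 0))
                                 (tapp g.[shift 1] (var 0))))
           (Id (arr A B) f g))
where "G |-{ ax } j" := (der ax G j).

Definition inhabited (ax : ctx -> judgement -> Prop) (G : ctx) (X : tm) : Prop :=
  exists t, G |-{ax} HasType t X.

(** * Polynomial functors, algebras and homotopy-initiality *)

(* In the following [A] is a type over G and [B] a type over [A :: G]. *)

Definition P (A B X : tm) : tm := Sig A (arr B X.[shift 1]).

(* Pf(pair(x,v)) = pair(x, f o v) *)
Definition Pmap (f : tm) : tm :=
  lam (tsplit (var 0) (tpair (var 1) (comp f.[shift 3] (var 0)))).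

Definition Alg_hom (A B C sC D sD : tm) : tm :=
  Sig (arr C D)
      (Id (arr (P A B C) D).[shift 1]
          (comp (var 0) sC.[shift 1])
          (comp sD.[shift 1] (Pmap (var 0)))).

Definition contr (X : tm) : tm :=
  Sig X (Pi X.[shift 1] (Id X.[shift 2] (var 1) (var 0))).

Definition is_alg (ax : ctx -> judgement -> Prop) (G : ctx) (A B C sC : tm) : Prop :=
  G |-{ax} IsType C /\ G |-{ax} HasType sC (arr (P A B C) C).

(* The algebra (D, sD) may live in any extension of the ambient context G. *)
Definition homotopy_initial (ax : ctx -> judgement -> Prop) (G : ctx)
    (A B C sC : tm) : Prop :=
  is_alg ax G A B C sC /\
  forall (E : ctx) (D sD : tm),
    let s := shift (length E) in
    E ++ G |-{ax} IsCtx ->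
    is_alg ax (E ++ G) A.[s] B.[up s] D sD ->
    inhabited ax (E ++ G) (contr (Alg_hom A.[s] B.[up s] C.[s] sC.[s] D sD)).

(** * Rules for homotopical W-types *)

(* [sup] is an open term over x : A, t : B(x) -> W. *)
Definition W_ctx (G : ctx) (A B W : tm) : ctx := arr B W.[shift 1] :: A :: G.

(* Elimination and propositional computation in context G.
   [r] is wrec(w,c), a term over w : W; [q] is wcomp(x,u,c). *)
Definition W_elim_comp (ax : ctx -> judgement -> Prop) (G : ctx)
    (A B W sup : tm) : Prop :=
  forall C c : tm,
    W :: G |-{ax} IsType C ->
    Pi B.[shift 1] C.[tapp (var 1) (var 0) .: shift 3] :: W_ctx G A B W
      |-{ax} HasType c C.[sup.[shift 1] .: shift 3] ->
    exists r : tm, W :: G |-{ax} HasType r C /\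
    exists q : tm,
      W_ctx G A B W |-{ax} HasType q
        (Id C.[sup .: shift 2]
            r.[sup .: shift 2]
            c.[lam r.[tapp (var 1) (var 0) .: shift 3] .: shift 0]).

(* As for all rules of type theory, the premises of the elimination rule may
   depend on further variables, hence the extension E. *)
Record W_rules (ax : ctx -> judgement -> Prop) (G : ctx)
    (A B W sup : tm) : Prop := {
  W_form : G |-{ax} IsType W;
  W_intro : W_ctx G A B W |-{ax} HasType sup W.[shift 2];
  W_elim : forall E : ctx,
    let s := shift (length E) in
    E ++ G |-{ax} IsCtx ->
    W_elim_comp ax (E ++ G) A.[s] B.[up s] W.[s] sup.[up (up s)]
}.

(* s_W(pair(a,t)) = sup(a,t) *)
Definition alg_of_sup (sup : tm) : tm :=
  lam (tsplit (var 0) sup.[up (up (shift 1))]).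

(* sup(a,t) = s_W(pair(a,t)) *)
Definition sup_of_alg (sW : tm) : tm :=
  tapp sW.[shift 2] (tpair (var 1) (var 0)).

(* Main.v *)
(** The theory has no closed types and its definitional equality is arbitrary (there
    is no injectivity of Pi), so derivations are produced by reflection: terms are
    annotated with the types of their redexes, a checker that only contracts redexes
    with matching annotations is sound for derivability, and the type-theoretic
    arguments are written in a small surface language and checked by computation.

    Weak function extensionality is derived from the non-dependent rule as follows.
    For a family [S] over [X] contracted to a section [a], let [T] be the total space,
    [L t = pi_1 o t] and [N t = a o pi_1 o t] for [t : X -> T].  Extensionality gives
    [eps_t : t = N t]; since [L o N] and [L] agree definitionally, naturality of [eps]
    makes [L] of [eps_b] and [L] of [eps_a] equal loops, so a section [b] is equal to
    [a] over the identity of [X].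

    For W-types, the recursor provides a homomorphism [(f, p)] into any algebra, and a
    second elimination into [Pi g gamma. f w = g w], followed by induction on the
    resulting homotopy, contracts the type of homomorphisms to it.  Conversely, for a
    family [C] over an initial algebra, the homomorphism into [Sigma w. C w] gives a
    section of [C o g] compatible with [gamma], for some endomorphism [(g, gamma)];
    it is transported to the identity, whose structure path is refl at functions
    in eta-expanded form. *)
From Stdlib Require Import List Arith Lia Bool.
Require Import Defs.

(** * Raw syntax *)

(** Two obstacles shape the constructions. Function extensionality has no computation rule: its path
    at constant reflexivity need not be refl, and its value at a point need not be the given
    homotopy. Hence the normalised [sFE], with homotopy induction in place of computation. And eta
    is only propositional, so a function composed with an identity differs definitionally from the
    function; statements are proved for lambda-abstractions and transported along [sEta]. The
    hypotheses enter the scripts as symbols realised by raw terms, so that every check is a closed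
    computation. Elimination and initiality merely assert that some raw terms exist; such a step is
    taken outside the scripts, which are cut there and resume with the new terms as further symbols.
    Context extensions are absorbed at the end by weakening the data first. *)

Lemma up_ext s s' : (forall n, s n = s' n) -> forall n, up s n = up s' n.
Proof. intros H [|n]; cbn; congruence. Qed.

Lemma subst_ext t : forall s s', (forall n, s n = s' n) -> t.[s] = t.[s'].
Proof.
  induction t; intros r r' H; cbn; f_equal; auto using up_ext.
  apply IHt2; induction k; cbn; auto using up_ext.
Qed.

Lemma ren_subst t :
  forall r s, (forall n, var (r n) = s n) -> ren r t = t.[s].
Proof.
  assert (U : forall r s, (forall n, var (r n) = s n) ->
                     forall n, var (upr r n) = up s n)
    by (intros r s H [|n]; cbn; rewrite <- ?H; auto).
  induction t; intros r s H; cbn; auto; f_equal; auto.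
  apply IHt2; induction k; cbn; auto.
Qed.

Lemma ren_ren t :
  forall r r' r'', (forall n, r (r' n) = r'' n) -> ren r (ren r' t) = ren r'' t.
Proof.
  assert (U : forall r r' r'', (forall n, r (r' n) = r'' n) ->
                          forall n, upr r (upr r' n) = upr r'' n)
    by (intros r r' r'' H [|n]; cbn; rewrite ?H; auto).
  induction t; intros r r' r'' H; cbn; auto; f_equal; auto.
  apply IHt2; induction k; cbn; auto.
Qed.

Lemma subst_ren t :
  forall r s s', (forall n, s (r n) = s' n) -> (ren r t).[s] = t.[s'].
Proof.
  assert (U : forall r s s', (forall n, s (r n) = s' n) ->
                        forall n, up s (upr r n) = up s' n)
    by (intros r s s' H [|n]; cbn; rewrite ?H; auto).
  induction t; intros r s s' H; cbn; auto; f_equal; auto.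
  apply IHt2; induction k; cbn; auto.
Qed.

Lemma ren_of_subst t :
  forall s r s', (forall n, ren r (s n) = s' n) -> ren r t.[s] = t.[s'].
Proof.
  assert (U : forall s r s', (forall n, ren r (s n) = s' n) ->
                        forall n, ren (upr r) (up s n) = up s' n).
  { intros s r s' H [|n]; cbn; auto.
    rewrite <- H, !(ren_ren _ _ _ (fun n => S (r n))); auto. }
  induction t; intros s r s' H; cbn; auto; f_equal; auto.
  apply IHt2; induction k; cbn; auto.
Qed.

Lemma subst_subst_ext t :
  forall s s' s'', (forall n, (s n).[s'] = s'' n) -> t.[s].[s'] = t.[s''].
Proof.
  assert (U : forall s s' s'', (forall n, (s n).[s'] = s'' n) ->
                          forall n, (up s n).[up s'] = up s'' n).
  { intros s s' s'' H [|n]; cbn; auto.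
    rewrite <- H, (subst_ren _ _ _ (fun n => ren S (s' n))) by auto.
    symmetry; apply ren_of_subst; auto. }
  induction t; intros s s' s'' H; cbn; auto; f_equal; auto.
  apply IHt2; induction k; cbn; auto.
Qed.

Lemma subst_subst t s s' : t.[s].[s'] = t.[fun n => (s n).[s']].
Proof. apply subst_subst_ext; auto. Qed.

Lemma subst_var t : forall s, (forall n, s n = var n) -> t.[s] = t.
Proof.
  assert (U : forall s, (forall n, s n = var n) -> forall n, up s n = var n)
    by (intros s H [|n]; cbn; rewrite ?H; auto).
  induction t; intros s H; cbn; auto; f_equal; auto.
  apply IHt2; induction k; cbn; auto.
Qed.

Lemma subst_shift0 t : t.[shift 0] = t.
Proof. apply subst_var; reflexivity. Qed.

(* Proves equations between raw terms by comparing the composite substitutions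
   pointwise. *)
Ltac push :=
  cbn [subst ren jsubst]; unfold arr, comp;
  rewrite ?(fun t r => ren_subst t r (fun n => var (r n)) (fun _ => eq_refl));
  rewrite ?subst_subst.
Ltac tmeq_leaf :=
  cbn; repeat (unfold shift; cbn); first [reflexivity | f_equal; lia].
Ltac tmeq_at d :=
  intros; push; cbn;
  rewrite ?(fun t r => ren_subst t r (fun n => var (r n)) (fun _ => eq_refl));
  rewrite ?subst_subst;
  first
  [ reflexivity
  | lazymatch goal with
    | |- ?t.[_] = ?t.[_] => apply subst_ext; tmeq_pt d
    | |- ?t.[_] = ?t => apply subst_var; tmeq_pt d
    | |- ?t = ?t.[_] => symmetry; apply subst_var; tmeq_pt d
    | |- @eq nat _ _ => lia
    | |- _ => progress f_equal; tmeq_at d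
    end ]
with tmeq_pt d :=
  lazymatch d with
  | S ?d => let n := fresh "n" in intro n; tmeq_case 5 d n
  end
with tmeq_case k d n :=
  first
  [ solve [tmeq_leaf]
  | lazymatch k with
    | S ?k => destruct n as [|n]; [tmeq_at d | tmeq_case k d n]
    | 0 => tmeq_at d
    end ].
Ltac tmeq := tmeq_at 4.

(** * Derivability *)

Section Der.
Variable ax : ctx -> judgement -> Prop.
Local Notation "G ||- j" := (der ax G j) (at level 70).

Lemma der_eq G G' j j' : G ||- j -> G = G' -> j = j' -> G' ||- j'.
Proof. intros H -> ->; exact H. Qed.

Lemma der_ctx G j : G ||- j -> G ||- IsCtx.
Proof. induction 1; eauto using d_nil, d_cons. Qed.

(** Besides [d_cons], the rules [d_ax] and [d_subst] can conclude [IsCtx]; both have [IsCtx] of the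
    same context as a premise, so the induction passes through them. *)
Lemma ctx_inv G A : A :: G ||- IsCtx -> G ||- IsType A.
Proof.
  remember (A :: G) as D eqn:E; remember IsCtx as j eqn:Ej.
  intros H; revert G A E Ej; induction H; intros; subst; try discriminate; eauto.
  congruence.
Qed.

Lemma ctx_tail G A : A :: G ||- IsCtx -> G ||- IsCtx.
Proof. intros H; eapply der_ctx, ctx_inv, H. Qed.

Definition typed_subst (D : ctx) (s : nat -> tm) (G : ctx) : Prop :=
  forall n A, nth_error G n = Some A ->
    D ||- HasType (s n) A.[shift (S n)].[s].

Lemma typed_subst_ext D s s' G :
  typed_subst D s G -> (forall n, s n = s' n) -> typed_subst D s' G.
Proof.
  intros H E n A HA; rewrite <- E, <- (subst_ext _ _ _ E); apply H, HA.
Qed.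

Lemma typed_shift D G : D ++ G ||- IsCtx -> typed_subst (D ++ G) (shift (length D)) G.
Proof.
  intros H n A HA.
  eapply der_eq; [apply (d_var ax _ (length D + n) A H) | reflexivity |].
  - rewrite nth_error_app2 by lia. now replace (length D + n - length D) with n by lia.
  - f_equal; tmeq.
Qed.

Lemma typed_id G : G ||- IsCtx -> typed_subst G (shift 0) G.
Proof. apply (typed_shift []). Qed.

Lemma typed_cons D s G a A :
  D ||- HasType a A.[s] -> typed_subst D s G -> typed_subst D (a .: s) (A :: G).
Proof.
  intros Ha Hs [|n] X HX; cbn in HX.
  - injection HX as <-. eapply der_eq; [exact Ha | reflexivity | f_equal; tmeq].
  - eapply der_eq; [exact (Hs n X HX) | reflexivity | f_equal; tmeq].
Qed.

Lemma der_wk G A j : G ||- IsType A -> G ||- j -> A :: G ||- jsubst (shift 1) j.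
Proof.
  intros HA H; eapply d_subst; [exact H | now apply d_cons |].
  apply (typed_shift [A]); now apply d_cons.
Qed.

Lemma typed_up D s G A :
  typed_subst D s G -> D ||- IsType A.[s] ->
  typed_subst (A.[s] :: D) (up s) (A :: G).
Proof.
  (* [up] weakens by renaming, the typing rules by substitution; the lift is first put in the second
     form. *)
  intros Hs HA. apply (typed_subst_ext _ (var 0 .: fun n => (s n).[shift 1])).
  - apply typed_cons.
    + eapply der_eq; [apply (d_var ax (A.[s] :: D) 0); [now apply d_cons | reflexivity]
                     | reflexivity | f_equal; tmeq].
    + intros n X HX.
      eapply der_eq; [apply (der_wk _ _ _ HA (Hs n X HX)) | reflexivity | cbn; f_equal; tmeq].
  - intros [|n]; tmeq.
Qed.

(** The identity substitution carries judgements from [A :: G] to [A' :: G], its head variable being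
    typed by conversion. *)
Lemma ctx_conv G A A' j :
  G ||- IsType A' -> G ||- EqType A' A -> A :: G ||- j -> A' :: G ||- j.
Proof.
  intros HA' E H. assert (C : A' :: G ||- IsCtx) by now apply d_cons.
  eapply der_eq; [eapply (d_subst ax (A :: G) (A' :: G) (shift 0)); [exact H | exact C |]
                 | reflexivity |].
  - intros n X HX; destruct n as [|n]; cbn in HX.
    + injection HX as <-. rewrite subst_shift0.
      eapply d_conv; [apply (d_var ax (A' :: G) 0 A' C eq_refl) |].
      apply (der_wk G A' (EqType A' A)); auto.
    + rewrite subst_shift0; apply (d_var ax (A' :: G) (S n) X C HX).
  - destruct j; cbn; now rewrite ?subst_shift0.
Qed.

Lemma subst1 G A a j :
  A :: G ||- j -> G ||- HasType a A -> G ||- jsubst (a .: shift 0) j.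
Proof.
  intros H Ha. eapply d_subst; [exact H | eapply der_ctx, Ha |].
  apply typed_cons; [now rewrite subst_shift0 | eapply typed_id, der_ctx, Ha].
Qed.

Definition eq_substs (D : ctx) (s t : nat -> tm) (G : ctx) : Prop :=
  forall n X, nth_error G n = Some X ->
    D ||- HasType (s n) X.[shift (S n)].[s] /\
    D ||- HasType (t n) X.[shift (S n)].[s] /\
    D ||- EqTerm (s n) (t n) X.[shift (S n)].[s].

(** In [eq_substs] the entries of [t] are typed at types instantiated by [s]. Once the earlier
    entries are handled, [d_subst_eqtype] turns such a type into the one instantiated by [t]; hence
    the induction on [G]. *)
Lemma eq_substs_typed D s t G :
  G ||- IsCtx -> D ||- IsCtx -> eq_substs D s t G -> typed_subst D t G.
Proof.
  revert s t; induction G as [|A G IH]; intros s t HG HD H; [intros [|n]; discriminate|].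
  assert (HA := ctx_inv _ _ HG). assert (HG' := der_ctx _ _ HA).
  assert (Htail : eq_substs D (fun n => s (S n)) (fun n => t (S n)) G).
  { intros n X HX. destruct (H (S n) X HX) as (h1 & h2 & h3).
    assert (E : X.[shift (S (S n))].[s] = X.[shift (S n)].[fun n => s (S n)]) by tmeq.
    rewrite E in h1, h2, h3; auto. }
  assert (Ht := IH _ _ HG' HD Htail).
  assert (EA : D ||- EqType A.[fun n => s (S n)] A.[fun n => t (S n)]).
  { eapply d_subst_eqtype; eauto; intros n X HX; apply (Htail n X HX). }
  apply (typed_subst_ext _ (t 0 .: fun n => t (S n))); [|intros [|n]; reflexivity].
  apply typed_cons; auto.
  eapply d_conv; [| exact EA].
  destruct (H 0 A eq_refl) as (_ & h & _).
  eapply der_eq; [exact h | reflexivity | f_equal; tmeq].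
Qed.

Lemma eq_substs_type D s t G A :
  D ||- IsCtx -> eq_substs D s t G -> G ||- IsType A -> D ||- EqType A.[s] A.[t].
Proof.
  intros HD H HA.
  eapply d_subst_eqtype; [exact HA | exact HD | | |].
  - intros n X HX; apply (H n X HX).
  - eapply eq_substs_typed; eauto using der_ctx.
  - intros n X HX; apply (H n X HX).
Qed.

Lemma eq_substs_term D s t G a A :
  D ||- IsCtx -> eq_substs D s t G -> G ||- HasType a A ->
  D ||- EqTerm a.[s] a.[t] A.[s].
Proof.
  intros HD H HA.
  eapply d_subst_eqterm; [exact HA | exact HD | | |].
  - intros n X HX; apply (H n X HX).
  - eapply eq_substs_typed; eauto using der_ctx.
  - intros n X HX; apply (H n X HX).
Qed.

Lemma eq_substs_refl D s G : typed_subst D s G -> eq_substs D s s G.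
Proof. intros H n X HX; repeat split; auto using d_term_refl. Qed.

Lemma eq_substs_cons D s t G a b A :
  D ||- HasType a A.[s] -> D ||- HasType b A.[s] -> D ||- EqTerm a b A.[s] ->
  eq_substs D s t G -> eq_substs D (a .: s) (b .: t) (A :: G).
Proof.
  intros h1 h2 h3 H [|n] X HX; cbn in HX.
  - injection HX as <-. assert (E : A.[s] = A.[shift 1].[a .: s]) by tmeq.
    rewrite E in h1, h2, h3; auto.
  - assert (E : X.[shift (S n)].[s] = X.[shift (S (S n))].[a .: s]) by tmeq.
    destruct (H n X HX) as (e1 & e2 & e3); rewrite E in e1, e2, e3; auto.
Qed.

Lemma eq_substs_id G : G ||- IsCtx -> eq_substs G (shift 0) (shift 0) G.
Proof. intros; now apply eq_substs_refl, typed_id. Qed.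

End Der.

(** * Annotated syntax *)

(* [aMeta i l] is the [i]-th declared symbol applied to [l], most recent variable
   first. *)
Inductive aterm : Type :=
| aVar (n : nat)
| aMeta (i : nat) (l : list aterm)
| aId (A a b : aterm)
| aRefl (A a : aterm)
| aJ (A E a b p d : aterm)
| aSig (A B : aterm)
| aPair (A B a b : aterm)
| aSplit (A B C e d : aterm)
| aPi (A B : aterm)
| aLam (A B b : aterm)
| aApp (A B f a : aterm)
| aExt (A B f g h : aterm).

Section AtermInd.
Variable Q : aterm -> Prop.
Hypothesis (hVar : forall n, Q (aVar n))
  (hMeta : forall i l, Forall Q l -> Q (aMeta i l))
  (hId : forall A a b, Q A -> Q a -> Q b -> Q (aId A a b))
  (hRefl : forall A a, Q A -> Q a -> Q (aRefl A a))
  (hJ : forall A E a b p d, Q A -> Q E -> Q a -> Q b -> Q p -> Q d -> Q (aJ A E a b p d))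
  (hSig : forall A B, Q A -> Q B -> Q (aSig A B))
  (hPair : forall A B a b, Q A -> Q B -> Q a -> Q b -> Q (aPair A B a b))
  (hSplit : forall A B C e d, Q A -> Q B -> Q C -> Q e -> Q d -> Q (aSplit A B C e d))
  (hPi : forall A B, Q A -> Q B -> Q (aPi A B))
  (hLam : forall A B b, Q A -> Q B -> Q b -> Q (aLam A B b))
  (hApp : forall A B f a, Q A -> Q B -> Q f -> Q a -> Q (aApp A B f a))
  (hExt : forall A B f g h, Q A -> Q B -> Q f -> Q g -> Q h -> Q (aExt A B f g h)).

Fixpoint aterm_nested_ind (t : aterm) : Q t :=
  match t with
  | aVar n => hVar n
  | aMeta i l =>
      hMeta i l ((fix go l : Forall Q l :=
        match l with
        | [] => Forall_nil _
        | a :: l => Forall_cons _ (aterm_nested_ind a) (go l)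
        end) l)
  | aId A a b => hId A a b (aterm_nested_ind A) (aterm_nested_ind a) (aterm_nested_ind b)
  | aRefl A a => hRefl A a (aterm_nested_ind A) (aterm_nested_ind a)
  | aJ A E a b p d =>
      hJ A E a b p d (aterm_nested_ind A) (aterm_nested_ind E) (aterm_nested_ind a)
        (aterm_nested_ind b) (aterm_nested_ind p) (aterm_nested_ind d)
  | aSig A B => hSig A B (aterm_nested_ind A) (aterm_nested_ind B)
  | aPair A B a b =>
      hPair A B a b (aterm_nested_ind A) (aterm_nested_ind B)
        (aterm_nested_ind a) (aterm_nested_ind b)
  | aSplit A B C e d =>
      hSplit A B C e d (aterm_nested_ind A) (aterm_nested_ind B)
        (aterm_nested_ind C) (aterm_nested_ind e) (aterm_nested_ind d)
  | aPi A B => hPi A B (aterm_nested_ind A) (aterm_nested_ind B)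
  | aLam A B b => hLam A B b (aterm_nested_ind A) (aterm_nested_ind B) (aterm_nested_ind b)
  | aApp A B f a =>
      hApp A B f a (aterm_nested_ind A) (aterm_nested_ind B)
        (aterm_nested_ind f) (aterm_nested_ind a)
  | aExt A B f g h =>
      hExt A B f g h (aterm_nested_ind A) (aterm_nested_ind B)
        (aterm_nested_ind f) (aterm_nested_ind g) (aterm_nested_ind h)
  end.
End AtermInd.

Fixpoint aren (r : nat -> nat) (t : aterm) : aterm :=
  match t with
  | aVar n => aVar (r n)
  | aMeta i l => aMeta i (map (aren r) l)
  | aId A a b => aId (aren r A) (aren r a) (aren r b)
  | aRefl A a => aRefl (aren r A) (aren r a)
  | aJ A E a b p d =>
      aJ (aren r A) (aren (upr (upr (upr r))) E) (aren r a) (aren r b) (aren r p)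
        (aren (upr r) d)
  | aSig A B => aSig (aren r A) (aren (upr r) B)
  | aPair A B a b => aPair (aren r A) (aren (upr r) B) (aren r a) (aren r b)
  | aSplit A B C e d =>
      aSplit (aren r A) (aren (upr r) B) (aren (upr r) C) (aren r e)
        (aren (upr (upr r)) d)
  | aPi A B => aPi (aren r A) (aren (upr r) B)
  | aLam A B b => aLam (aren r A) (aren (upr r) B) (aren (upr r) b)
  | aApp A B f a => aApp (aren r A) (aren (upr r) B) (aren r f) (aren r a)
  | aExt A B f g h => aExt (aren r A) (aren r B) (aren r f) (aren r g) (aren r h)
  end.

Definition acons (t : aterm) (s : nat -> aterm) : nat -> aterm :=
  fun n => match n with 0 => t | S m => s m end.
Definition ashift (k : nat) : nat -> aterm := fun n => aVar (k + n).
Definition aup (s : nat -> aterm) : nat -> aterm :=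
  acons (aVar 0) (fun n => aren S (s n)).

Fixpoint asubst (s : nat -> aterm) (t : aterm) : aterm :=
  match t with
  | aVar n => s n
  | aMeta i l => aMeta i (map (asubst s) l)
  | aId A a b => aId (asubst s A) (asubst s a) (asubst s b)
  | aRefl A a => aRefl (asubst s A) (asubst s a)
  | aJ A E a b p d =>
      aJ (asubst s A) (asubst (aup (aup (aup s))) E) (asubst s a) (asubst s b)
        (asubst s p) (asubst (aup s) d)
  | aSig A B => aSig (asubst s A) (asubst (aup s) B)
  | aPair A B a b => aPair (asubst s A) (asubst (aup s) B) (asubst s a) (asubst s b)
  | aSplit A B C e d =>
      aSplit (asubst s A) (asubst (aup s) B) (asubst (aup s) C) (asubst s e)
        (asubst (aup (aup s)) d)
  | aPi A B => aPi (asubst s A) (asubst (aup s) B)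
  | aLam A B b => aLam (asubst s A) (asubst (aup s) B) (asubst (aup s) b)
  | aApp A B f a => aApp (asubst s A) (asubst (aup s) B) (asubst s f) (asubst s a)
  | aExt A B f g h =>
      aExt (asubst s A) (asubst s B) (asubst s f) (asubst s g) (asubst s h)
  end.

(** Replaces the telescope of a symbol by its arguments; variables beyond the telescope are ambient
    and skip the [n] local ones. *)
Fixpoint inst (n : nat) (l : list tm) : nat -> tm :=
  match l with
  | [] => shift n
  | a :: l => a .: inst n l
  end.

(* Erasure below [n] local variables: indices from [n] on refer to an ambient
   context, over which the raw terms [Ms] realising the symbols live. *)
Fixpoint er (Ms : list tm) (n : nat) (t : aterm) : tm :=
  match t with
  | aVar i => var i
  | aMeta i l => (nth i Ms (con 0)).[inst n (map (er Ms n) l)]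
  | aId A a b => Id (er Ms n A) (er Ms n a) (er Ms n b)
  | aRefl _ a => refl (er Ms n a)
  | aJ _ _ a b p d => J (er Ms n a) (er Ms n b) (er Ms n p) (er Ms (S n) d)
  | aSig A B => Sig (er Ms n A) (er Ms (S n) B)
  | aPair _ _ a b => tpair (er Ms n a) (er Ms n b)
  | aSplit _ _ _ e d => tsplit (er Ms n e) (er Ms (S (S n)) d)
  | aPi A B => Pi (er Ms n A) (er Ms (S n) B)
  | aLam _ _ b => lam (er Ms (S n) b)
  | aApp _ _ f a => tapp (er Ms n f) (er Ms n a)
  | aExt _ _ f g h => tapp (funext (er Ms n f) (er Ms n g)) (er Ms n h)
  end.

(** Realisers in [Ms] mention ambient variables that annotated syntax does not show. Erasure is
    therefore compared only with renamings and substitutions that act on the ambient part by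
    changing the number of local variables before it. *)
Definition ren_above (n m : nat) (r : nat -> nat) : Prop :=
  forall k, r (n + k) = m + k.
Definition subst_above (n m : nat) (s : nat -> aterm) : Prop :=
  forall k, s (n + k) = aVar (m + k).

Lemma ren_above_up n m r : ren_above n m r -> ren_above (S n) (S m) (upr r).
Proof. intros H k; cbn; now rewrite H. Qed.

Lemma ren_above_plus n k : ren_above n (k + n) (Nat.add k).
Proof. intros j; lia. Qed.

Lemma subst_above_up n m s : subst_above n m s -> subst_above (S n) (S m) (aup s).
Proof. intros H k; cbn; now rewrite H. Qed.

Lemma subst_above_cons n m s a :
  subst_above n m s -> subst_above (S n) m (acons a s).
Proof. intros H k; apply H. Qed.

Lemma subst_above_shift n k : subst_above n (k + n) (ashift k).
Proof. intros j; unfold ashift; f_equal; lia. Qed.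

Lemma er_ren Ms t : forall n m r,
  ren_above n m r -> er Ms m (aren r t) = ren r (er Ms n t).
Proof.
  induction t using aterm_nested_ind; intros n' m r H'; cbn;
    try (repeat f_equal; eauto using ren_above_up; fail).
  symmetry; apply ren_of_subst. intros k; revert k.
  induction H as [|a l Ha Hl IH]; intros k; cbn.
  - unfold shift; cbn; now rewrite H'.
  - destruct k; cbn; auto. symmetry; auto.
Qed.

Lemma er_up Ms n m s i :
  subst_above n m s ->
  er Ms (S m) (aup s i) = up (fun i => er Ms m (s i)) i.
Proof.
  intros H; destruct i; cbn; auto.
  apply er_ren; intros k; reflexivity.
Qed.

Lemma er_subst Ms t : forall n m s,
  subst_above n m s -> er Ms m (asubst s t) = (er Ms n t).[fun i => er Ms m (s i)].
Proof.
  assert (U : forall t n m s, subst_above n m s ->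
    (er Ms (S n) t).[fun i => er Ms (S m) (aup s i)] =
    (er Ms (S n) t).[up (fun i => er Ms m (s i))])
    by (intros; apply subst_ext; intros; eapply er_up; eauto).
  assert (U2 : forall t n m s, subst_above n m s ->
    (er Ms (S (S n)) t).[fun i => er Ms (S (S m)) (aup (aup s) i)] =
    (er Ms (S (S n)) t).[up (up (fun i => er Ms m (s i)))]).
  { intros t' n m s H; rewrite (U _ _ _ _ (subst_above_up _ _ _ H)).
    apply subst_ext, up_ext; intros; eapply er_up; eauto. }
  induction t using aterm_nested_ind; intros n' m s H'; cbn; auto;
    try (repeat f_equal; try solve [eauto]; rewrite <- ?(U _ _ _ _ H'), <- ?(U2 _ _ _ _ H');
         eauto using subst_above_up; fail).
  rewrite subst_subst. apply subst_ext. intros k; revert k.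
  induction H as [|a l Ha Hl IH]; intros k; cbn.
  - now rewrite H'.
  - destruct k; cbn; auto.
Qed.

(** * Annotated typing *)

Section Wf.
Variables (ax : ctx -> judgement -> Prop) (G : ctx) (Ms : list tm).
Local Notation "G ||- j" := (der ax G j) (at level 70).

Definition ambient (n : nat) (D : ctx) : Prop :=
  forall k, nth_error D (n + k) = nth_error G k.

(* Conversion is derivable equality of erasures; the annotations make up for the
   missing injectivity of Pi, Sig and Id when typing derivations are inverted. *)
Inductive wf_type : nat -> ctx -> aterm -> Prop :=
| wf_tmeta n D i l m T :
    nth_error Ms i = Some m -> T ++ G ||- IsType m ->
    D ||- IsCtx -> ambient n D -> wf_args n D l T ->
    wf_type n D (aMeta i l)
| wf_Id n D A a b :
    wf_type n D A -> wf_term n D a (er Ms n A) -> wf_term n D b (er Ms n A) ->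
    wf_type n D (aId A a b)
| wf_Sig n D A B :
    wf_type n D A -> wf_type (S n) (er Ms n A :: D) B -> wf_type n D (aSig A B)
| wf_Pi n D A B :
    wf_type n D A -> wf_type (S n) (er Ms n A :: D) B -> wf_type n D (aPi A B)
with wf_term : nat -> ctx -> aterm -> tm -> Prop :=
| wf_var n D i X :
    D ||- IsCtx -> nth_error D i = Some X ->
    wf_term n D (aVar i) X.[shift (S i)]
| wf_meta n D i l m T X :
    nth_error Ms i = Some m -> T ++ G ||- HasType m X -> T ++ G ||- IsType X ->
    D ||- IsCtx -> ambient n D -> wf_args n D l T ->
    wf_term n D (aMeta i l) X.[inst n (map (er Ms n) l)]
| wf_refl n D A a :
    wf_type n D A -> wf_term n D a (er Ms n A) ->
    wf_term n D (aRefl A a) (Id (er Ms n A) (er Ms n a) (er Ms n a))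
| wf_J n D A E a b p d :
    wf_type n D A ->
    wf_type (S (S (S n)))
      (Id (er Ms n A).[shift 2] (var 1) (var 0) :: (er Ms n A).[shift 1] :: er Ms n A :: D) E ->
    wf_term (S n) (er Ms n A :: D) d
      (er Ms (S (S (S n))) E).[refl (var 0) .: var 0 .: var 0 .: shift 1] ->
    wf_term n D a (er Ms n A) -> wf_term n D b (er Ms n A) ->
    wf_term n D p (Id (er Ms n A) (er Ms n a) (er Ms n b)) ->
    wf_term n D (aJ A E a b p d)
      (er Ms (S (S (S n))) E).[er Ms n p .: er Ms n b .: er Ms n a .: shift 0]
| wf_pair n D A B a b :
    wf_type n D A -> wf_type (S n) (er Ms n A :: D) B ->
    wf_term n D a (er Ms n A) ->
    wf_term n D b (er Ms (S n) B).[er Ms n a .: shift 0] ->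
    wf_term n D (aPair A B a b) (Sig (er Ms n A) (er Ms (S n) B))
| wf_split n D A B C e d :
    wf_type n D A -> wf_type (S n) (er Ms n A :: D) B ->
    wf_type (S n) (Sig (er Ms n A) (er Ms (S n) B) :: D) C ->
    wf_term n D e (Sig (er Ms n A) (er Ms (S n) B)) ->
    wf_term (S (S n)) (er Ms (S n) B :: er Ms n A :: D) d
      (er Ms (S n) C).[tpair (var 1) (var 0) .: shift 2] ->
    wf_term n D (aSplit A B C e d) (er Ms (S n) C).[er Ms n e .: shift 0]
| wf_lam n D A B b :
    wf_type n D A -> wf_type (S n) (er Ms n A :: D) B ->
    wf_term (S n) (er Ms n A :: D) b (er Ms (S n) B) ->
    wf_term n D (aLam A B b) (Pi (er Ms n A) (er Ms (S n) B))
| wf_app n D A B f a :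
    wf_type n D A -> wf_type (S n) (er Ms n A :: D) B ->
    wf_term n D f (Pi (er Ms n A) (er Ms (S n) B)) -> wf_term n D a (er Ms n A) ->
    wf_term n D (aApp A B f a) (er Ms (S n) B).[er Ms n a .: shift 0]
| wf_ext n D A B f g h :
    wf_type n D A -> wf_type n D B ->
    wf_term n D f (arr (er Ms n A) (er Ms n B)) ->
    wf_term n D g (arr (er Ms n A) (er Ms n B)) ->
    wf_term n D h (Pi (er Ms n A)
      (Id (er Ms n B).[shift 1] (tapp (er Ms n f).[shift 1] (var 0))
                                (tapp (er Ms n g).[shift 1] (var 0)))) ->
    wf_term n D (aExt A B f g h)
      (Id (arr (er Ms n A) (er Ms n B)) (er Ms n f) (er Ms n g))
| wf_conv n D t T T' :
    wf_term n D t T -> D ||- EqType T T' -> wf_term n D t T'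
with wf_args : nat -> ctx -> list aterm -> ctx -> Prop :=
| wf_nil n D : wf_args n D [] []
| wf_cons n D a l X T :
    wf_args n D l T -> wf_term n D a X.[inst n (map (er Ms n) l)] ->
    wf_args n D (a :: l) (X :: T).

Scheme wf_type_mut := Minimality for wf_type Sort Prop
with wf_term_mut := Minimality for wf_term Sort Prop
with wf_args_mut := Minimality for wf_args Sort Prop.
Combined Scheme wf_ind from wf_type_mut, wf_term_mut, wf_args_mut.

Lemma wf_term_eq n D D' t T T' :
  wf_term n D t T -> D = D' -> T = T' -> wf_term n D' t T'.
Proof. intros H -> ->; exact H. Qed.

Lemma nth_of_error i m : nth_error Ms i = Some m -> nth i Ms (con 0) = m.
Proof. apply nth_error_nth. Qed.

Lemma typed_inst_nil n D : D ||- IsCtx -> ambient n D -> typed_subst ax D (shift n) G.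
Proof.
  intros HD Hn k A HA.
  eapply der_eq; [apply (d_var ax D (n + k) A HD) | reflexivity | f_equal; tmeq].
  now rewrite Hn.
Qed.

Lemma wf_sound :
  (forall n D T, wf_type n D T -> D ||- IsType (er Ms n T)) /\
  (forall n D t T, wf_term n D t T -> D ||- HasType (er Ms n t) T) /\
  (forall n D l T, wf_args n D l T -> D ||- IsCtx -> ambient n D ->
     typed_subst ax D (inst n (map (er Ms n) l)) (T ++ G)).
Proof.
  apply wf_ind; intros; cbn;
    repeat match goal with H : nth_error _ _ = Some _ |- _ =>
             try rewrite (nth_of_error _ _ H); revert H end; intros;
    try solve [econstructor; eauto].
  - eapply (d_subst ax _ _ _ (IsType m)); eauto.
    match goal with H : _ -> _ -> typed_subst _ _ _ _ |- _ => apply H; auto end.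
  - eapply (d_subst ax _ _ _ (HasType m X)); eauto.
    match goal with H : _ -> _ -> typed_subst _ _ _ _ |- _ => apply H; auto end.
  - eapply d_app in H8; [|eapply d_funext; eauto].
    eapply der_eq; [exact H8 | reflexivity | f_equal; tmeq].
  - apply typed_inst_nil; auto.
  - apply typed_cons; auto.
Qed.

Definition wf_subst n m (s : nat -> aterm) D D' : Prop :=
  subst_above n m s /\ ambient m D' /\ D' ||- IsCtx /\
  forall i X, nth_error D i = Some X ->
    wf_term m D' (s i) X.[shift (S i)].[fun i => er Ms m (s i)].

Lemma wf_subst_typed n m s D D' :
  wf_subst n m s D D' -> typed_subst ax D' (fun i => er Ms m (s i)) D.
Proof. intros (_ & _ & _ & H) i X HX. apply wf_sound, (H i X HX). Qed.

Lemma inst_subst n m s l T :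
  subst_above n m s ->
  (T.[inst n (map (er Ms n) l)]).[fun i => er Ms m (s i)] =
  T.[inst m (map (er Ms m) (map (asubst s) l))].
Proof.
  intros H; apply subst_subst_ext; induction l as [|a l IH]; intros [|k]; cbn; auto.
  - specialize (H 0); rewrite H; cbn. reflexivity.
  - rewrite H; reflexivity.
  - symmetry; now apply er_subst.
Qed.

Lemma ambient_cons n D X : ambient n D -> ambient (S n) (X :: D).
Proof. intros H k; apply H. Qed.

Lemma J_ctx D A : D ||- IsType A ->
  Id A.[shift 2] (var 1) (var 0) :: A.[shift 1] :: A :: D ||- IsCtx.
Proof.
  intros HA. assert (h1 := der_wk ax _ _ _ HA HA). cbn in h1.
  assert (h2 := der_wk ax _ _ _ h1 h1). cbn in h2.
  assert (E : A.[shift 1].[shift 1] = A.[shift 2]) by tmeq.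
  assert (C : A.[shift 1] :: A :: D ||- IsCtx) by now apply d_cons.
  apply d_cons, d_Id.
  - now rewrite <- E.
  - exact (d_var ax _ 1 A C eq_refl).
  - rewrite <- E; exact (d_var ax _ 0 A.[shift 1] C eq_refl).
Qed.

(** * Closure of annotated typing under renaming and substitution *)

Section Closure.
Variable Q : nat -> nat -> (nat -> aterm) -> ctx -> ctx -> Prop.
Hypothesis Q_wf : forall n m s D D', Q n m s D D' -> wf_subst n m s D D'.
Hypothesis Q_up : forall n m s D D' A, Q n m s D D' ->
  D' ||- IsType A.[fun i => er Ms m (s i)] ->
  Q (S n) (S m) (aup s) (A :: D) (A.[fun i => er Ms m (s i)] :: D').

Lemma Q_up' n m s D D' A A' : Q n m s D D' -> D' ||- IsType A' ->
  A.[fun i => er Ms m (s i)] = A' ->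
  Q (S n) (S m) (aup s) (A :: D) (A' :: D').
Proof. intros H HA <-; auto. Qed.

Lemma Q_up_er n m s D D' A : Q n m s D D' -> D' ||- IsType (er Ms m (asubst s A)) ->
  Q (S n) (S m) (aup s) (er Ms n A :: D) (er Ms m (asubst s A) :: D').
Proof.
  intros H HA. apply Q_up'; auto. symmetry; apply er_subst, (Q_wf _ _ _ _ _ H).
Qed.

Lemma up_up n m s T : subst_above n m s ->
  T.[fun i => er Ms (S m) (aup s i)] = T.[up (fun i => er Ms m (s i))].
Proof. intros H; apply subst_ext; intros; eapply er_up; eauto. Qed.

(** Lifting a substitution under a binder weakens its entries, and weakening is itself closure under
    renamings. So the proof is done once for a class [Q] stable under lifting, and used first with
    [wf_ren], then with [wf_subst]. *)
Lemma closure :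
  (forall n D T, wf_type n D T -> forall m D' s, Q n m s D D' ->
     wf_type m D' (asubst s T)) /\
  (forall n D t T, wf_term n D t T -> forall m D' s, Q n m s D D' ->
     wf_term m D' (asubst s t) T.[fun i => er Ms m (s i)]) /\
  (forall n D l T, wf_args n D l T -> forall m D' s, Q n m s D D' ->
     wf_args m D' (map (asubst s) l) T).
Proof.
  destruct wf_sound as (snd1 & snd2 & _).
  apply wf_ind; intros;
  match goal with HQ : Q _ _ _ _ _ |- _ =>
    destruct (Q_wf _ _ _ _ _ HQ) as (Hs & Ham & HD & Hty) end.
  - cbn; econstructor; eauto.
  - cbn. assert (E := er_subst Ms A _ _ _ Hs).
    constructor; [auto | rewrite E; auto | rewrite E; auto].
  - cbn; constructor; [auto|]. apply H2, Q_up_er; auto.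
  - cbn; constructor; [auto|]. apply H2, Q_up_er; auto.
  - cbn. eauto.
  - cbn. rewrite (inst_subst _ _ _ _ _ Hs). econstructor; eauto.
  - cbn. rewrite <- !(er_subst Ms _ _ _ _ Hs). constructor; auto.
    rewrite (er_subst Ms _ _ _ _ Hs); auto.
  - assert (EA := er_subst Ms A _ _ _ Hs).
    assert (HA := snd1 _ _ _ (H0 _ _ _ H11)).
    assert (C := J_ctx _ _ HA).
    assert (Q1 := Q_up_er _ _ _ _ _ _ H11 HA).
    assert (Q2 : Q (S (S n)) (S (S m)) (aup (aup s)) ((er Ms n A).[shift 1] :: er Ms n A :: D)
              ((er Ms m (asubst s A)).[shift 1] :: er Ms m (asubst s A) :: D')).
    { apply Q_up'; auto.
      - apply ctx_tail, ctx_inv in C; exact C.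
      - rewrite (up_up _ _ _ _ Hs), EA. tmeq. }
    assert (Q3 := Q_up' _ _ _ _ _ (Id (er Ms n A).[shift 2] (var 1) (var 0)) _
                    Q2 (ctx_inv _ _ _ C)).
    assert (E3 : forall X, X.[fun i => er Ms (S (S (S m))) (aup (aup (aup s)) i)] =
                      X.[up (up (up (fun i => er Ms m (s i))))]).
    { intros X. rewrite (up_up _ _ _ _ (subst_above_up _ _ _ (subst_above_up _ _ _ Hs))).
      apply subst_ext, up_ext; intros i.
      rewrite (er_up _ _ _ _ _ (subst_above_up _ _ _ Hs)).
      apply up_ext; intros; eapply er_up; eauto. }
    assert (EE : er Ms (S (S (S m))) (asubst (aup (aup (aup s))) E) =
                 (er Ms (S (S (S n))) E).[up (up (up (fun i => er Ms m (s i))))]).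
    { rewrite <- E3; apply er_subst; auto using subst_above_up. }
    cbn. eapply wf_term_eq; [apply wf_J | reflexivity |].
    + auto.
    + apply H2, Q3. cbn. f_equal.
      rewrite (up_up _ _ _ _ (subst_above_up _ _ _ Hs)), EA.
      erewrite subst_ext with (s := up _);
        [|apply up_ext; intros; eapply er_up; eauto]. tmeq.
    + eapply wf_term_eq; [apply H4, Q1 | reflexivity |].
      rewrite (up_up _ _ _ _ Hs), EE. tmeq.
    + rewrite EA; auto.
    + rewrite EA; auto.
    + rewrite !(er_subst Ms _ _ _ _ Hs); auto.
    + rewrite EE, !(er_subst Ms _ _ _ _ Hs). tmeq.
  - assert (E := er_subst Ms A _ _ _ Hs).
    assert (EB := er_subst Ms B _ _ _ (subst_above_up _ _ _ Hs)).
    rewrite (up_up _ _ _ _ Hs) in EB.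
    cbn. rewrite <- E, <- EB. apply wf_pair; auto.
    + apply H2, Q_up_er; auto.
    + rewrite E; auto.
    + eapply wf_term_eq; [apply H6, H7 | reflexivity |].
      rewrite EB, !(er_subst Ms _ _ _ _ Hs). tmeq.
  - assert (E := er_subst Ms A _ _ _ Hs).
    assert (EB := er_subst Ms B _ _ _ (subst_above_up _ _ _ Hs)).
    assert (EC := er_subst Ms C _ _ _ (subst_above_up _ _ _ Hs)).
    rewrite (up_up _ _ _ _ Hs) in EB; rewrite (up_up _ _ _ _ Hs) in EC.
    assert (HA := snd1 _ _ _ (H0 _ _ _ H9)).
    assert (Q1 := Q_up_er _ _ _ _ _ _ H9 HA).
    assert (HB := snd1 _ _ _ (H2 _ _ _ Q1)).
    cbn. eapply wf_term_eq; [apply wf_split | reflexivity |].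
    + auto.
    + apply H2, Q1.
    + apply H4, Q_up'; auto.
      * apply d_Sig; auto.
      * cbn. now rewrite E, EB.
    + rewrite E, EB. apply H6, H9.
    + eapply wf_term_eq; [apply H8, Q_up_er, HB; exact Q1 | reflexivity |].
      rewrite EC, (up_up _ _ _ _ (subst_above_up _ _ _ Hs)).
      erewrite subst_ext with (s := up (fun _ => er _ _ _));
        [|apply up_ext; intros; eapply er_up; eauto]. tmeq.
    + rewrite EC, !(er_subst Ms _ _ _ _ Hs). tmeq.
  - assert (E := er_subst Ms A _ _ _ Hs).
    assert (EB := er_subst Ms B _ _ _ (subst_above_up _ _ _ Hs)).
    rewrite (up_up _ _ _ _ Hs) in EB.
    cbn. rewrite <- E, <- EB. apply wf_lam; auto.
    + apply H2, Q_up_er; auto.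
    + eapply wf_term_eq; [apply H4, Q_up_er; [exact H5 | auto] | reflexivity |].
      rewrite ?EB; exact (up_up _ _ _ _ Hs).
  - assert (E := er_subst Ms A _ _ _ Hs).
    assert (EB := er_subst Ms B _ _ _ (subst_above_up _ _ _ Hs)).
    rewrite (up_up _ _ _ _ Hs) in EB.
    cbn. eapply wf_term_eq; [apply wf_app | reflexivity |]; auto.
    + apply H2, Q_up_er; auto.
    + rewrite E, EB; apply H4, H7.
    + rewrite E; auto.
    + rewrite EB, !(er_subst Ms _ _ _ _ Hs). tmeq.
  - assert (E := fun A => er_subst Ms A _ _ _ Hs).
    cbn. eapply wf_term_eq; [apply wf_ext | reflexivity |]; auto.
    + rewrite !E. eapply wf_term_eq; [apply H4; eauto | reflexivity | tmeq].
    + rewrite !E. eapply wf_term_eq; [apply H6; eauto | reflexivity | tmeq].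
    + rewrite !E. eapply wf_term_eq; [apply H8; eauto | reflexivity | tmeq].
    + rewrite !E. tmeq.
  - eapply wf_conv; [eauto|].
    eapply (d_subst ax _ _ _ (EqType T T')); eauto using wf_subst_typed.
  - constructor.
  - cbn. constructor; auto. rewrite <- (inst_subst _ _ _ _ _ Hs); auto.
Qed.
End Closure.
End Wf.

Lemma aren_asubst t : forall r s, (forall i, aVar (r i) = s i) -> aren r t = asubst s t.
Proof.
  assert (U : forall r s, (forall i, aVar (r i) = s i) ->
                     forall i, aVar (upr r i) = aup s i)
    by (intros r s H [|i]; cbn; rewrite <- ?H; auto).
  induction t using aterm_nested_ind; intros r s H'; cbn; auto; f_equal; auto 10.
  induction H; cbn; f_equal; auto.
Qed.

Fixpoint ainst (n : nat) (l : list aterm) : nat -> aterm :=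
  match l with
  | [] => ashift n
  | a :: l => acons a (ainst n l)
  end.

Section Wf.
Variables (ax : ctx -> judgement -> Prop) (G : ctx) (Ms : list tm).
Local Notation "G ||- j" := (der ax G j) (at level 70).
Local Notation wf_type := (wf_type ax G Ms).
Local Notation wf_term := (wf_term ax G Ms).
Local Notation wf_args := (wf_args ax G Ms).
Local Notation wf_subst := (wf_subst ax G Ms).
Local Notation ambient := (ambient G).

Lemma wf_type_der n D T : wf_type n D T -> D ||- IsType (er Ms n T).
Proof. apply wf_sound. Qed.
Lemma wf_term_der n D t T : wf_term n D t T -> D ||- HasType (er Ms n t) T.
Proof. apply wf_sound. Qed.

(** Substitutions by variables whose types match as raw terms: lifting them needs no weakening
    lemma, which breaks the circle. *)
Definition wf_ren (n m : nat) (s : nat -> aterm) (D D' : ctx) : Prop :=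
  subst_above n m s /\ ambient m D' /\ D' ||- IsCtx /\
  exists r, (forall i, aVar (r i) = s i) /\
    forall i X, nth_error D i = Some X ->
      exists X', nth_error D' (r i) = Some X' /\
        X'.[shift (S (r i))] = X.[shift (S i)].[fun i => er Ms m (s i)].

Lemma wf_ren_subst n m s D D' : wf_ren n m s D D' -> wf_subst n m s D D'.
Proof.
  intros (H1 & H2 & H3 & r & H4 & H5). repeat split; auto.
  intros i X HX. destruct (H5 i X HX) as (X' & H6 & H7).
  rewrite <- H4, <- H7. now apply wf_var.
Qed.

Lemma wf_ren_up n m s D D' A : wf_ren n m s D D' ->
  D' ||- IsType A.[fun i => er Ms m (s i)] ->
  wf_ren (S n) (S m) (aup s) (A :: D) (A.[fun i => er Ms m (s i)] :: D').
Proof.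
  intros (H1 & H2 & H3 & r & H4 & H5) HA.
  split; [now apply subst_above_up|]. split; [now apply ambient_cons|].
  split; [now apply d_cons|]. exists (upr r); split.
  - intros [|i]; cbn; rewrite <- ?H4; auto.
  - intros [|i] X HX; cbn in HX.
    + injection HX as <-. eexists; split; [reflexivity|].
      rewrite (up_up _ _ _ _ _ H1). tmeq.
    + destruct (H5 i X HX) as (X' & H6 & H7). exists X'; split; auto.
      rewrite (up_up _ _ _ _ _ H1).
      transitivity (X'.[shift (S (r i))].[shift 1]); [tmeq|]. rewrite H7. tmeq.
Qed.

Lemma wf_ren_shift n X D : ambient n D -> X ++ D ||- IsCtx ->
  wf_ren n (length X + n) (ashift (length X)) D (X ++ D).
Proof.
  intros Hn HD. split; [apply subst_above_shift|].
  split.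
  { intros k. rewrite nth_error_app2 by lia. rewrite <- Hn. f_equal; lia. }
  split; auto. exists (Nat.add (length X)); split; [reflexivity|].
  intros i Y HY. exists Y; split.
  - rewrite nth_error_app2 by lia. rewrite <- HY; f_equal; lia.
  - tmeq.
Qed.

Lemma wf_type_wk n X D T : wf_type n D T -> ambient n D -> X ++ D ||- IsCtx ->
  wf_type (length X + n) (X ++ D) (aren (Nat.add (length X)) T).
Proof.
  intros H Hn HX. rewrite (aren_asubst _ _ (ashift (length X))) by reflexivity.
  apply (proj1 (closure ax G Ms wf_ren wf_ren_subst wf_ren_up) _ _ _ H).
  now apply wf_ren_shift.
Qed.

Lemma wf_term_wk n X D t T : wf_term n D t T -> ambient n D -> X ++ D ||- IsCtx ->
  wf_term (length X + n) (X ++ D) (aren (Nat.add (length X)) t) T.[shift (length X)].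
Proof.
  intros H Hn HX. rewrite (aren_asubst _ _ (ashift (length X))) by reflexivity.
  apply (proj1 (proj2 (closure ax G Ms wf_ren wf_ren_subst wf_ren_up)) _ _ _ _ H).
  now apply wf_ren_shift.
Qed.

Lemma wf_subst_up n m s D D' A : wf_subst n m s D D' ->
  D' ||- IsType A.[fun i => er Ms m (s i)] ->
  wf_subst (S n) (S m) (aup s) (A :: D) (A.[fun i => er Ms m (s i)] :: D').
Proof.
  intros (H1 & H2 & H3 & H4) HA.
  assert (C : A.[fun i => er Ms m (s i)] :: D' ||- IsCtx) by now apply d_cons.
  split; [now apply subst_above_up|]. split; [now apply ambient_cons|].
  split; [auto|].
  intros [|i] X HX; cbn in HX.
  - injection HX as <-.
    eapply wf_term_eq; [apply wf_var; [exact C | reflexivity] | reflexivity |].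
    rewrite (up_up _ _ _ _ _ H1). tmeq.
  - eapply wf_term_eq;
      [apply (wf_term_wk m [A.[fun i => er Ms m (s i)]] D'); eauto | reflexivity |].
    rewrite (up_up _ _ _ _ _ H1). cbn [length]. tmeq.
Qed.

Lemma wf_type_subst n m s D D' T :
  wf_type n D T -> wf_subst n m s D D' -> wf_type m D' (asubst s T).
Proof.
  intros H; eapply (closure ax G Ms wf_subst); eauto using wf_subst_up.
Qed.

Lemma wf_term_subst n m s D D' t T :
  wf_term n D t T -> wf_subst n m s D D' ->
  wf_term m D' (asubst s t) T.[fun i => er Ms m (s i)].
Proof.
  intros H; eapply (closure ax G Ms wf_subst); eauto using wf_subst_up.
Qed.

Lemma wf_term_ctx n D t T : wf_term n D t T -> D ||- IsCtx.
Proof. intros H; eapply der_ctx, wf_term_der, H. Qed.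

Lemma wf_subst_id n D : ambient n D -> D ||- IsCtx -> wf_subst n n (ashift 0) D D.
Proof. intros; apply wf_ren_subst, (wf_ren_shift n []); auto. Qed.

Lemma wf_subst_cons n m s D D' a A :
  wf_subst n m s D D' -> wf_term m D' a A.[fun i => er Ms m (s i)] ->
  wf_subst (S n) m (acons a s) (A :: D) D'.
Proof.
  intros (H1 & H2 & H3 & H4) Ha. repeat split; auto.
  intros [|i] X HX; cbn in HX.
  - injection HX as <-. eapply wf_term_eq; [exact Ha | reflexivity | tmeq].
  - eapply wf_term_eq; [exact (H4 i X HX) | reflexivity | tmeq].
Qed.

Lemma er_ainst n l i : er Ms n (ainst n l i) = inst n (map (er Ms n) l) i.
Proof. revert i; induction l; intros [|i]; cbn; auto. Qed.

Lemma wf_subst_args m D l T :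
  wf_args m D l T -> D ||- IsCtx -> ambient m D ->
  wf_subst (length l) m (ainst m l) (T ++ G) D.
Proof.
  intros H HD Hm; induction H; cbn.
  - split; [intros k; cbn; reflexivity|]. repeat split; auto.
    intros i X HX. eapply wf_term_eq;
      [apply (wf_var ax G Ms n D (n + i)); [auto | rewrite Hm; exact HX] | reflexivity | tmeq].
  - apply wf_subst_cons; auto.
    eapply wf_term_eq; [eassumption | reflexivity |].
    apply subst_ext; intros; now rewrite er_ainst.
Qed.

Lemma wf_subst1 n D a A :
  wf_term n D a A -> ambient n D ->
  wf_subst (S n) n (acons a (ashift 0)) (A :: D) D.
Proof.
  intros H Hn. apply wf_subst_cons; [apply wf_subst_id; eauto using wf_term_ctx|].
  eapply wf_term_eq; [exact H | reflexivity | tmeq].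
Qed.

Lemma wf_type_subst1 n D T a A :
  wf_type (S n) (A :: D) T -> wf_term n D a A -> ambient n D ->
  wf_type n D (asubst (acons a (ashift 0)) T).
Proof. intros H Ha Hn; eapply wf_type_subst; eauto using wf_subst1. Qed.

Lemma wf_term_subst1 n D t T a A :
  wf_term (S n) (A :: D) t T -> wf_term n D a A -> ambient n D ->
  wf_term n D (asubst (acons a (ashift 0)) t) T.[er Ms n a .: shift 0].
Proof.
  intros H Ha Hn.
  eapply wf_term_eq; [eapply wf_term_subst; eauto using wf_subst1 | reflexivity | tmeq].
Qed.

Lemma er_subst1 n t a :
  er Ms n (asubst (acons a (ashift 0)) t) = (er Ms (S n) t).[er Ms n a .: shift 0].
Proof.
  rewrite (er_subst Ms t (S n) n) by apply subst_above_cons, (subst_above_shift n 0).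
  tmeq.
Qed.

Lemma lam_inv n D A B b T : wf_term n D (aLam A B b) T ->
  wf_type n D A /\ wf_type (S n) (er Ms n A :: D) B /\
  wf_term (S n) (er Ms n A :: D) b (er Ms (S n) B) /\
  D ||- EqType (Pi (er Ms n A) (er Ms (S n) B)) T.
Proof.
  remember (aLam A B b) as t eqn:E; intros H; induction H; try discriminate.
  - injection E as -> -> ->. repeat split; auto.
    apply d_type_refl, d_Pi; auto using wf_type_der.
  - destruct (IHwf_term E) as (h1 & h2 & h3 & h4); eauto using d_type_trans.
Qed.

Lemma pair_inv n D A B a b T : wf_term n D (aPair A B a b) T ->
  wf_type n D A /\ wf_type (S n) (er Ms n A :: D) B /\
  wf_term n D a (er Ms n A) /\
  wf_term n D b (er Ms (S n) B).[er Ms n a .: shift 0].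
Proof.
  remember (aPair A B a b) as t eqn:E; intros H; induction H; try discriminate; auto.
  injection E as -> -> -> ->. auto.
Qed.

Lemma refl_inv n D A a T : wf_term n D (aRefl A a) T ->
  wf_type n D A /\ wf_term n D a (er Ms n A).
Proof.
  remember (aRefl A a) as t eqn:E; intros H; induction H; try discriminate; auto.
  injection E as -> ->. auto.
Qed.

End Wf.

(** * Normalisation *)

(* Compares erasures: annotations are ignored. *)
Fixpoint aeq (t t' : aterm) : bool :=
  match t, t' with
  | aVar i, aVar j => Nat.eqb i j
  | aMeta i l, aMeta j l' =>
      Nat.eqb i j &&
      (fix go l l' := match l, l' with
       | [], [] => true
       | a :: l, a' :: l' => aeq a a' && go l l'
       | _, _ => false
       end) l l'
  | aId A a b, aId A' a' b' => aeq A A' && aeq a a' && aeq b b'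
  | aRefl _ a, aRefl _ a' => aeq a a'
  | aJ _ _ a b p d, aJ _ _ a' b' p' d' => aeq a a' && aeq b b' && aeq p p' && aeq d d'
  | aSig A B, aSig A' B' => aeq A A' && aeq B B'
  | aPair _ _ a b, aPair _ _ a' b' => aeq a a' && aeq b b'
  | aSplit _ _ _ e d, aSplit _ _ _ e' d' => aeq e e' && aeq d d'
  | aPi A B, aPi A' B' => aeq A A' && aeq B B'
  | aLam _ _ b, aLam _ _ b' => aeq b b'
  | aApp _ _ f a, aApp _ _ f' a' => aeq f f' && aeq a a'
  | aExt _ _ f g h, aExt _ _ f' g' h' => aeq f f' && aeq g g' && aeq h h'
  | _, _ => false
  end.

Lemma aeq_er Ms t : forall t' n, aeq t t' = true -> er Ms n t = er Ms n t'.
Proof.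
  induction t using aterm_nested_ind; intros [] n'; cbn; try discriminate;
    rewrite ?andb_true_iff, ?Nat.eqb_eq; intros;
    repeat match goal with H : _ /\ _ |- _ => destruct H end; subst; auto;
    first [solve [f_equal; auto] | solve [f_equal; [f_equal; auto | auto]] | idtac].
  apply subst_ext; intros i'; f_equal.
  match goal with H : _ = true |- _ => revert H end. revert l0.
  induction H; intros [|a' l']; cbn; try discriminate; auto.
  rewrite andb_true_iff; intros [h1 h2]; f_equal; auto.
Qed.

Definition asubst1 (a : aterm) : aterm -> aterm := asubst (acons a (ashift 0)).

(** A redex fires only if the annotations of the eliminator and of the introduction form convert
    with the remaining fuel, and for J if both endpoints agree with the point of refl. Exhausted
    fuel returns the input, which is sound because equality with the input is claimed and normality
    is not. *)
Fixpoint nf (k : nat) (t : aterm) : aterm :=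
  match k with 0 => t | S k =>
  let same A B := aeq A B || aeq (nf k A) (nf k B) in
  match t with
  | aVar i => t
  | aMeta i l => aMeta i (map (nf k) l)
  | aId A a b => aId (nf k A) (nf k a) (nf k b)
  | aRefl A a => aRefl A (nf k a)
  | aJ A E a b p d =>
      let a' := nf k a in let b' := nf k b in let p' := nf k p in
      match
        match p' with
        | aRefl A' x => if same A A' && aeq a' x && aeq b' x then Some x else None
        | _ => None
        end
      with
      | Some x => nf k (asubst1 x d)
      | None => aJ A E a' b' p' (nf k d)
      end
  | aSig A B => aSig (nf k A) (nf k B)
  | aPair A B a b => aPair A B (nf k a) (nf k b)
  | aSplit A B C e d =>
      let e' := nf k e in
      match
        match e' with
        | aPair A' B' a b => if same A A' && same B B' then Some (a, b) else None
        | _ => None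
        end
      with
      | Some (a, b) => nf k (asubst (acons b (acons a (ashift 0))) d)
      | None => aSplit A B C e' (nf k d)
      end
  | aPi A B => aPi (nf k A) (nf k B)
  | aLam A B b => aLam A B (nf k b)
  | aApp A B f a =>
      let f' := nf k f in let a' := nf k a in
      match
        match f' with
        | aLam A' B' b => if same A A' && same B B' then Some b else None
        | _ => None
        end
      with
      | Some b => nf k (asubst1 a' b)
      | None => aApp A B f' a'
      end
  | aExt A B f g h => aExt A B (nf k f) (nf k g) (nf k h)
  end
  end.

Definition conv (k : nat) (A B : aterm) : bool := aeq A B || aeq (nf k A) (nf k B).

Section Nf.
Variables (ax : ctx -> judgement -> Prop) (G : ctx) (Ms : list tm).
Local Notation "G ||- j" := (der ax G j) (at level 70).
Local Notation wf_type := (wf_type ax G Ms).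
Local Notation wf_term := (wf_term ax G Ms).
Local Notation wf_args := (wf_args ax G Ms).
Local Notation wf_subst := (wf_subst ax G Ms).
Local Notation ambient := (ambient G).
Local Notation er := (er Ms).

Definition nf_type_ok (k : nat) : Prop := forall n D T,
  wf_type n D T -> ambient n D -> D ||- EqType (er n T) (er n (nf k T)).
Definition nf_term_ok (k : nat) : Prop := forall n D t T,
  wf_term n D t T -> ambient n D ->
  wf_term n D (nf k t) T /\ D ||- EqTerm (er n t) (er n (nf k t)) T.

(** Two codomain annotations live over contexts with different heads. Once the heads are equal, [Hj]
    carries the judgements about the second annotation to the context of the first. *)
Lemma conv_ctx_ok k n D D' T T' : nf_type_ok k ->
  wf_type n D T -> ambient n D -> wf_type n D' T' -> ambient n D' ->
  (forall j, D' ||- j -> D ||- j) ->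
  conv k T T' = true -> D ||- EqType (er n T) (er n T').
Proof.
  intros Hk HT HD HT' HD' Hj; unfold conv; rewrite orb_true_iff; intros [H|H].
  - rewrite (aeq_er Ms _ _ n H). apply d_type_refl, Hj, (wf_type_der ax G Ms); auto.
  - eapply d_type_trans; [apply Hk; eauto|]. rewrite (aeq_er Ms _ _ n H).
    apply d_type_sym, Hj, Hk; auto.
Qed.

Lemma conv_ok k n D T T' : nf_type_ok k ->
  wf_type n D T -> wf_type n D T' -> ambient n D ->
  conv k T T' = true -> D ||- EqType (er n T) (er n T').
Proof. intros; eapply conv_ctx_ok; eauto. Qed.

Lemma conv_under k n D A A' B B' : nf_type_ok k ->
  wf_type n D A -> wf_type n D A' -> ambient n D ->
  D ||- EqType (er n A) (er n A') ->
  wf_type (S n) (er n A :: D) B -> wf_type (S n) (er n A' :: D) B' ->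
  conv k B B' = true -> er n A :: D ||- EqType (er (S n) B) (er (S n) B').
Proof.
  intros; eapply conv_ctx_ok; eauto using ambient_cons.
  intros j Hj; eapply ctx_conv; eauto using wf_type_der.
Qed.

Lemma eq_subst1 D a b A : D ||- HasType a A -> D ||- HasType b A -> D ||- EqTerm a b A ->
  eq_substs ax D (a .: shift 0) (b .: shift 0) (A :: D).
Proof.
  intros; apply eq_substs_cons; rewrite ?subst_shift0; auto.
  eapply eq_substs_id, der_ctx; eauto.
Qed.

Lemma eq_type_subst1 D a b A T :
  D ||- HasType a A -> D ||- HasType b A -> D ||- EqTerm a b A ->
  A :: D ||- IsType T -> D ||- EqType T.[a .: shift 0] T.[b .: shift 0].
Proof.
  intros. eapply eq_substs_type; eauto using eq_subst1, der_ctx.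
Qed.

Lemma eq_type_subst_J D A a a' b b' p p' T :
  D ||- IsType A ->
  D ||- HasType a A -> D ||- HasType a' A -> D ||- EqTerm a a' A ->
  D ||- HasType b A -> D ||- HasType b' A -> D ||- EqTerm b b' A ->
  D ||- HasType p (Id A a b) -> D ||- HasType p' (Id A a b) ->
  D ||- EqTerm p p' (Id A a b) ->
  Id A.[shift 2] (var 1) (var 0) :: A.[shift 1] :: A :: D ||- IsType T ->
  D ||- EqType T.[p .: b .: a .: shift 0] T.[p' .: b' .: a' .: shift 0].
Proof.
  intros HA. intros.
  eapply eq_substs_type; [eapply der_ctx; eauto | | eassumption].
  assert (E1 : A.[shift 1].[a .: shift 0] = A) by tmeq.
  assert (E2 : (Id A.[shift 2] (var 1) (var 0)).[b .: a .: shift 0] = Id A a b)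
    by (cbn; f_equal; tmeq).
  apply eq_substs_cons; rewrite ?E2; auto.
  apply eq_substs_cons; rewrite ?E1; auto using eq_subst1.
Qed.

Lemma nf_args k n D l T : nf_term_ok k ->
  wf_args n D l T -> D ||- IsCtx -> ambient n D -> T ++ G ||- IsCtx ->
  wf_args n D (map (nf k) l) T /\
  eq_substs ax D (inst n (map (er n) l)) (inst n (map (er n) (map (nf k) l))) (T ++ G).
Proof.
  intros Hk H HD Hn; induction H; cbn; intros HT.
  - split; [constructor|]. now apply eq_substs_refl, (typed_inst_nil ax G).
  - destruct IHwf_args as [h1 h2]; eauto using ctx_tail.
    destruct (Hk _ _ _ _ H0 Hn) as [h3 h4].
    split.
    (* The type of the head is instantiated by the tail, which has been normalised too. *)
    + constructor; auto. eapply wf_conv; [exact h3|].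
      eapply eq_substs_type; eauto. now apply ctx_inv.
    + apply eq_substs_cons; auto; eapply wf_term_der; eauto.
Qed.

(** Congruence of [funext] is not a rule. It comes from substituting equal functions into the
    generic term [funext (var 1) (var 0)] over two function variables. *)
Lemma funext_cong D A B f f' g g' h h' :
  D ||- IsType A -> D ||- IsType B ->
  D ||- HasType f (arr A B) -> D ||- HasType f' (arr A B) -> D ||- EqTerm f f' (arr A B) ->
  D ||- HasType g (arr A B) -> D ||- HasType g' (arr A B) -> D ||- EqTerm g g' (arr A B) ->
  D ||- EqTerm h h' (Pi A (Id B.[shift 1] (tapp f.[shift 1] (var 0)) (tapp g.[shift 1] (var 0)))) ->
  D ||- EqTerm (tapp (funext f g) h) (tapp (funext f' g') h') (Id (arr A B) f g) /\
  D ||- EqType (Id (arr A B) f g) (Id (arr A B) f' g') /\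
  D ||- EqType (Pi A (Id B.[shift 1] (tapp f.[shift 1] (var 0)) (tapp g.[shift 1] (var 0))))
               (Pi A (Id B.[shift 1] (tapp f'.[shift 1] (var 0)) (tapp g'.[shift 1] (var 0)))).
Proof.
  intros HA HB Hf Hf' Ef Hg Hg' Eg Eh.
  assert (CA : A :: D ||- IsCtx) by now apply d_cons.
  assert (HB1 := der_wk ax _ _ _ HA HB); cbn in HB1.
  assert (HC : D ||- IsType (arr A B)) by now apply d_Pi.
  assert (HC1 := der_wk ax _ _ _ HC HC); cbn -[arr] in HC1.
  assert (C2 : (arr A B).[shift 1] :: arr A B :: D ||- IsCtx) by now apply d_cons.
  assert (wk2 : forall T, D ||- IsType T ->
            (arr A B).[shift 1] :: arr A B :: D ||- IsType T.[shift 2]).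
  { intros T HT. assert (h1 := der_wk ax _ _ _ HC1 (der_wk ax _ _ _ HC HT)).
    cbn in h1. eapply der_eq; [exact h1 | reflexivity | f_equal; tmeq]. }
  assert (F : (arr A B).[shift 1] :: arr A B :: D ||-
    HasType (funext (var 1) (var 0))
      (arr (Pi A.[shift 2] (Id B.[shift 2].[shift 1] (tapp (var 1).[shift 1] (var 0))
                                 (tapp (var 0).[shift 1] (var 0))))
           (Id (arr A.[shift 2] B.[shift 2]) (var 1) (var 0)))).
  { apply d_funext; auto.
    - eapply der_eq; [apply (d_var ax _ 1 _ C2 eq_refl) | reflexivity | f_equal; tmeq].
    - eapply der_eq; [apply (d_var ax _ 0 _ C2 eq_refl) | reflexivity | f_equal; tmeq]. }
  assert (ES : eq_substs ax D (g .: f .: shift 0) (g' .: f' .: shift 0)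
                 ((arr A B).[shift 1] :: arr A B :: D)).
  { assert (E : (arr A B).[shift 1].[f .: shift 0] = arr A B) by tmeq.
    apply eq_substs_cons; rewrite ?E; auto using eq_subst1. }
  assert (EF := eq_substs_term ax _ _ _ _ _ _ (der_ctx _ _ _ HA) ES F).
  split; [|split].
  - assert (EF' : D ||- EqTerm (funext f g) (funext f' g')
      (arr (Pi A (Id B.[shift 1] (tapp f.[shift 1] (var 0)) (tapp g.[shift 1] (var 0))))
           (Id (arr A B) f g))).
    { eapply der_eq; [exact EF | reflexivity | cbn; f_equal; tmeq]. }
    eapply der_eq; [exact (d_app_cong ax D _ _ _ _ _ _ EF' Eh) | reflexivity |].
    f_equal; tmeq.
  - apply d_Id_cong; auto. now apply d_type_refl.
  - assert (V := d_var ax _ 0 _ CA eq_refl). cbn -[shift] in V.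
    assert (app : forall u u', D ||- EqTerm u u' (arr A B) ->
              A :: D ||- EqTerm (tapp u.[shift 1] (var 0)) (tapp u'.[shift 1] (var 0)) B.[shift 1]).
    { intros u u' Hu. assert (Hu1 := der_wk ax _ _ _ HA Hu). cbn in Hu1.
      eapply der_eq; [eapply d_app_cong; [exact Hu1 | apply d_term_refl, V]
                     | reflexivity | f_equal; tmeq]. }
    apply d_Pi_cong; [now apply d_type_refl|].
    apply d_Id_cong; auto. now apply d_type_refl.
Qed.

(** Every recursive call of [nf] spends fuel, so the inner induction on typing is a mere case
    analysis except at conversion, which leaves the term in place. Typing is carried along because
    redexes are contracted after their parts have been normalised. *)
Lemma nf_ok k : nf_type_ok k /\ nf_term_ok k.
Proof.
  induction k as [|k [IHT IHt]].
  { split.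
    - intros n D T HT _; cbn. apply d_type_refl; eapply wf_type_der; eauto.
    - intros n D t T Ht _; cbn. split; auto. apply d_term_refl; eapply wf_term_der; eauto. }
  assert (W : forall n D t T, wf_term n D t T -> D ||- HasType (er n t) T)
    by (intros; eapply wf_term_der; eauto).
  assert (WT : forall n D T, wf_type n D T -> D ||- IsType (er n T))
    by (intros; eapply wf_type_der; eauto).
  assert (N1 : forall n D t T, wf_term n D t T -> ambient n D -> wf_term n D (nf k t) T)
    by (intros; now apply IHt).
  assert (N2 : forall n D t T, wf_term n D t T -> ambient n D ->
            D ||- EqTerm (er n t) (er n (nf k t)) T)
    by (intros; now apply IHt).
  enough (H : (forall n D T, wf_type n D T -> ambient n D ->
                 D ||- EqType (er n T) (er n (nf (S k) T))) /\
              (forall n D t T, wf_term n D t T -> ambient n D ->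
                 wf_term n D (nf (S k) t) T /\
                 D ||- EqTerm (er n t) (er n (nf (S k) t)) T) /\
              (forall n D l T, wf_args n D l T -> True))
    by (destruct H as (h1 & h2 & _); split; auto).
  apply wf_ind; auto.
  - intros n D i l m T Hi Hm HD _ Hl _ Hn. cbn.
    rewrite (nth_of_error _ _ _ Hi).
    destruct (nf_args k _ _ _ _ IHt Hl HD Hn (der_ctx _ _ _ Hm)).
    eapply eq_substs_type; eauto.
  - intros n D A a b HA _ Ha _ Hb _ Hn. cbn. apply d_Id_cong; auto.
  - intros n D A B HA _ HB _ Hn. cbn. apply d_Sig_cong; auto using ambient_cons.
  - intros n D A B HA _ HB _ Hn. cbn. apply d_Pi_cong; auto using ambient_cons.
  - intros n D i X HD Hi Hn. cbn. split; [now apply wf_var|].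
    apply d_term_refl, d_var; auto.
  - intros n D i l m T X Hi Hm HX HD _ Hl _ Hn. cbn.
    rewrite (nth_of_error _ _ _ Hi).
    destruct (nf_args k _ _ _ _ IHt Hl HD Hn (der_ctx _ _ _ Hm)).
    split; [|eapply eq_substs_term; eauto].
    eapply wf_conv; [eapply wf_meta; eauto|].
    apply d_type_sym. eapply eq_substs_type; eauto.
  - intros n D A a HA _ Ha _ Hn. cbn.
    assert (E : D ||- EqType (Id (er n A) (er n (nf k a)) (er n (nf k a)))
                  (Id (er n A) (er n a) (er n a))).
    { apply d_Id_cong; eauto using d_type_refl, d_term_sym. }
    split.
    + eapply wf_conv; [apply wf_refl; auto | exact E].
    + apply d_refl_cong; auto.
  - intros n D A E a b p d HA _ HE _ Hd _ Ha _ Hb _ Hp _ Hn.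
    assert (HnA := ambient_cons G n D (er n A) Hn).
    cbn [nf].
    set (a' := nf k a). set (b' := nf k b). set (p' := nf k p).
    assert (Ha' := N1 _ _ _ _ Ha Hn : wf_term n D a' _).
    assert (Hb' := N1 _ _ _ _ Hb Hn : wf_term n D b' _).
    assert (Hp' := N1 _ _ _ _ Hp Hn : wf_term n D p' _).
    assert (Ea := N2 _ _ _ _ Ha Hn). assert (Eb := N2 _ _ _ _ Hb Hn).
    assert (Ep := N2 _ _ _ _ Hp Hn).
    fold a' in Ea; fold b' in Eb; fold p' in Ep.
    (* Normalising the arguments changes the instance of the motive; [ET] equates the two instances,
       and both branches below convert along it. *)
    assert (ET := eq_type_subst_J _ _ _ _ _ _ _ _ _ (WT _ _ _ HA)
      (W _ _ _ _ Ha) (W _ _ _ _ Ha') Ea (W _ _ _ _ Hb) (W _ _ _ _ Hb') Eb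
      (W _ _ _ _ Hp) (W _ _ _ _ Hp') Ep (WT _ _ _ HE)).
    destruct (match p' with aRefl _ _ => _ | _ => _ end) as [x|] eqn:R.
    + destruct p' as [| | |A0 a0| | | | | | | |] eqn:Ep'; try discriminate.
      destruct ((aeq A A0 || aeq (nf k A) (nf k A0)) && aeq a' a0 && aeq b' a0) eqn:C;
        [|discriminate].
      injection R as <-. apply andb_true_iff in C as [C Cb]. apply andb_true_iff in C as [C Ca].
      destruct (refl_inv _ _ _ _ _ _ _ _ Hp') as [HA0 Hx].
      assert (EA := conv_ok k n D A A0 IHT HA HA0 Hn C).
      assert (Hx' : wf_term n D a0 (er n A)) by (eapply wf_conv; [exact Hx | now apply d_type_sym]).
      cbn in ET, Ep. rewrite (aeq_er Ms _ _ n Ca) in Ea, ET.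
      rewrite (aeq_er Ms _ _ n Cb) in Eb, ET.
      assert (Hr := wf_term_subst1 ax G Ms _ _ _ _ _ _ Hd Hx' Hn). fold (asubst1 a0 d) in Hr.
      match type of Hr with wf_term _ _ _ ?T =>
        replace T with (er (S (S (S n))) E).[refl (er n a0) .: er n a0 .: er n a0 .: shift 0]
          in Hr by tmeq end.
      assert (Hr' := wf_conv _ _ _ _ _ _ _ _ Hr (d_type_sym _ _ _ _ ET)).
      split; [apply N1; eauto|].
      eapply d_term_trans; [|now apply N2].
      eapply d_term_trans.
      * cbn. eapply d_J_cong; eauto using d_term_refl.
      * eapply d_conv_eq; [|apply d_type_sym; exact ET].
        unfold asubst1; rewrite er_subst1. eapply d_J_beta; eauto.
    + clear R. split.
      * eapply wf_conv; [|apply d_type_sym; exact ET].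
        apply wf_J; auto.
        eapply wf_conv; [exact Hp' | apply d_Id_cong; auto using d_type_refl].
      * cbn. eapply d_J_cong; eauto.
  - intros n D A B a b HA _ HB _ Ha _ Hb _ Hn. cbn. split.
    + apply wf_pair; auto. eapply wf_conv; [apply N1; eauto|].
      eapply eq_type_subst1; eauto.
    + apply d_pair_cong; auto.
  - intros n D A B C e d HA _ HB _ HC _ He _ Hd _ Hn.
    assert (HnA := ambient_cons G n D (er n A) Hn).
    assert (HnB := ambient_cons G _ _ (er (S n) B) HnA).
    cbn [nf]. set (e' := nf k e).
    assert (He' := N1 _ _ _ _ He Hn : wf_term n D e' _).
    assert (Ee := N2 _ _ _ _ He Hn). fold e' in Ee.
    assert (ET := eq_type_subst1 _ _ _ _ _ (W _ _ _ _ He) (W _ _ _ _ He') Ee (WT _ _ _ HC)).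
    destruct (match e' with aPair _ _ _ _ => _ | _ => _ end) as [[a b]|] eqn:R.
    + destruct e' as [| | | | | |A0 B0 a0 b0| | | | |] eqn:Ee'; try discriminate.
      destruct ((aeq A A0 || aeq (nf k A) (nf k A0)) &&
                (aeq B B0 || aeq (nf k B) (nf k B0))) eqn:Cv; [|discriminate].
      injection R as -> ->. apply andb_true_iff in Cv as [CA CB].
      destruct (pair_inv _ _ _ _ _ _ _ _ _ _ He') as (HA' & HB' & Ha & Hb).
      assert (EA := conv_ok k n D A A0 IHT HA HA' Hn CA).
      assert (EB := conv_under k n D A A0 B B0 IHT HA HA' Hn EA HB HB' CB).
      assert (Ha1 : wf_term n D a (er n A)) by (eapply wf_conv; [exact Ha | now apply d_type_sym]).
      assert (Hb1 : wf_term n D b (er (S n) B).[er n a .: shift 0]).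
      { eapply wf_conv; [exact Hb|]. apply d_type_sym.
        exact (subst1 ax _ _ _ _ EB (W _ _ _ _ Ha1)). }
      assert (Hr : wf_term n D (asubst (acons b (acons a (ashift 0))) d)
                     (er (S n) C).[er n e .: shift 0]).
      { eapply wf_conv; [|apply d_type_sym; exact ET].
        eapply wf_term_eq; [eapply wf_term_subst; [exact Hd|] | reflexivity | cbn; tmeq].
        apply wf_subst_cons; [apply wf_subst1; eauto|].
        eapply wf_term_eq; [exact Hb1 | reflexivity | tmeq]. }
      split; [apply N1; eauto|].
      eapply d_term_trans; [|now apply N2].
      eapply d_term_trans.
      * cbn. eapply d_split_cong; eauto using d_term_refl.
      * eapply d_conv_eq; [|apply d_type_sym; exact ET].
        rewrite (er_subst Ms d (S (S n)) n)
          by (do 2 apply subst_above_cons; exact (subst_above_shift n 0)).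
        cbn. eapply der_eq; [eapply d_split_beta; eauto | reflexivity | f_equal; tmeq].
    + clear R. split.
      * eapply wf_conv; [|apply d_type_sym; exact ET].
        apply wf_split; auto.
      * cbn. eapply d_split_cong; eauto.
  - intros n D A B b HA _ HB _ Hb _ Hn. cbn.
    assert (HnA := ambient_cons G n D (er n A) Hn). split.
    + apply wf_lam; auto.
    + apply d_lam_cong; auto.
  - intros n D A B f a HA _ HB _ Hf _ Ha _ Hn.
    cbn [nf]. set (f' := nf k f). set (a' := nf k a).
    assert (Hf' := N1 _ _ _ _ Hf Hn : wf_term n D f' _).
    assert (Ef := N2 _ _ _ _ Hf Hn). fold f' in Ef.
    assert (Ha' := N1 _ _ _ _ Ha Hn : wf_term n D a' _).
    assert (Ea := N2 _ _ _ _ Ha Hn). fold a' in Ea.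
    assert (ET := eq_type_subst1 _ _ _ _ _ (W _ _ _ _ Ha) (W _ _ _ _ Ha') Ea (WT _ _ _ HB)).
    destruct (match f' with aLam _ _ _ => _ | _ => _ end) as [b|] eqn:R.
    + destruct f' as [| | | | | | | | |A0 B0 b0| |] eqn:Ef'; try discriminate.
      destruct ((aeq A A0 || aeq (nf k A) (nf k A0)) &&
                (aeq B B0 || aeq (nf k B) (nf k B0))) eqn:Cv; [|discriminate].
      injection R as ->. apply andb_true_iff in Cv as [CA CB].
      destruct (lam_inv _ _ _ _ _ _ _ _ _ Hf') as (HA' & HB' & Hb & _).
      assert (EA := conv_ok k n D A A0 IHT HA HA' Hn CA).
      assert (EB := conv_under k n D A A0 B B0 IHT HA HA' Hn EA HB HB' CB).
      assert (Ha1 := wf_conv _ _ _ _ _ _ _ _ Ha' EA).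
      assert (Hr : wf_term n D (asubst1 a' b) (er (S n) B).[er n a .: shift 0]).
      { eapply wf_conv; [|apply d_type_sym; exact ET].
        eapply wf_conv; [eapply wf_term_subst1; eauto|]. apply d_type_sym.
        exact (subst1 ax _ _ _ _ EB (W _ _ _ _ Ha')). }
      split; [apply N1; eauto|].
      eapply d_term_trans; [|now apply N2].
      eapply d_term_trans.
      * cbn. eapply d_app_cong; eauto.
      * eapply d_conv_eq; [|apply d_type_sym; exact ET].
        unfold asubst1; rewrite er_subst1. cbn.
        eapply d_conv_eq; [eapply d_beta; eauto|]. apply d_type_sym.
        exact (subst1 ax _ _ _ _ EB (W _ _ _ _ Ha')).
    + clear R. split.
      * eapply wf_conv; [|apply d_type_sym; exact ET]. apply wf_app; auto.
      * cbn. eapply d_app_cong; eauto.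
  - intros n D A B f g h HA _ HB _ Hf _ Hg _ Hh _ Hn. cbn.
    destruct (funext_cong D (er n A) (er n B) (er n f) (er n (nf k f)) (er n g) (er n (nf k g))
      (er n h) (er n (nf k h))) as (h1 & h2 & h3); eauto.
    split; auto.
    eapply wf_conv; [|apply d_type_sym; exact h2].
    apply wf_ext; auto. eapply wf_conv; [apply N1; eauto | exact h3].
  - intros n D t T T' Ht IH E Hn. destruct (IH Hn) as [h1 h2].
    split; [eapply wf_conv; eauto | eapply d_conv_eq; eauto].
Qed.

End Nf.

(** * Type checking *)

(** The telescope of each symbol, most recent variable first, and its type; [None] marks a symbol
    that is a type. *)
Definition signature := list (list aterm * option aterm).

Definition aweak (k : nat) : aterm -> aterm := aren (Nat.add k).

Definition path_ctx (A : aterm) (D : list aterm) : list aterm :=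
  aId (aweak 2 A) (aVar 1) (aVar 0) :: aweak 1 A :: A :: D.
Definition refl_case (A E : aterm) : aterm :=
  asubst (acons (aRefl (aweak 1 A) (aVar 0)) (acons (aVar 0) (acons (aVar 0) (ashift 1)))) E.
Definition pair_case (A B C : aterm) : aterm :=
  asubst (acons (aPair (aweak 2 A) (aren (upr (Nat.add 2)) B) (aVar 1) (aVar 0)) (ashift 2)) C.
Definition pointwise_type (A B f g : aterm) : aterm :=
  let app f := aApp (aweak 1 A) (aweak 2 B) (aweak 1 f) (aVar 0) in
  aPi A (aId (aweak 1 B) (app f) (app g)).

Section Check.
Variable S : signature.

(** The branch types [refl_case] and [pair_case], and [pointwise_type], are themselves checked to be
    types: computation replaces a typing lemma for each. *)
Fixpoint ckT (k : nat) (D : list aterm) (T : aterm) : bool :=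
  match k with 0 => false | Datatypes.S k =>
  let check t T := match ck k D t with Some T' => conv k T' T | None => false end in
  match T with
  | aMeta i l => match nth_error S i with Some (X, None) => ckA k D l X | _ => false end
  | aId A a b => ckT k D A && check a A && check b A
  | aSig A B | aPi A B => ckT k D A && ckT k (A :: D) B
  | _ => false
  end
  end
with ck (k : nat) (D : list aterm) (t : aterm) : option aterm :=
  match k with 0 => None | Datatypes.S k =>
  let check D t T := match ck k D t with Some T' => conv k T' T | None => false end in
  match t with
  | aVar i => option_map (aweak (Datatypes.S i)) (nth_error D i)
  | aMeta i l =>
      match nth_error S i with
      | Some (X, Some T) =>
          if ckA k D l X then Some (asubst (ainst (length D) l) T) else None
      | _ => None
      end
  | aRefl A a => if ckT k D A && check D a A then Some (aId A a a) else None
  | aJ A E a b p d =>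
      if ckT k D A && ckT k (path_ctx A D) E && ckT k (A :: D) (refl_case A E)
         && check (A :: D) d (refl_case A E) && check D a A && check D b A
         && check D p (aId A a b)
      then Some (asubst (acons p (acons b (acons a (ashift 0)))) E) else None
  | aPair A B a b =>
      if ckT k D A && ckT k (A :: D) B && check D a A && check D b (asubst1 a B)
      then Some (aSig A B) else None
  | aSplit A B C e d =>
      if ckT k D A && ckT k (A :: D) B && ckT k (aSig A B :: D) C
         && check D e (aSig A B) && ckT k (B :: A :: D) (pair_case A B C)
         && check (B :: A :: D) d (pair_case A B C)
      then Some (asubst1 e C) else None
  | aLam A B b =>
      if ckT k D A && ckT k (A :: D) B && check (A :: D) b B
      then Some (aPi A B) else None
  | aApp A B f a =>
      if ckT k D A && ckT k (A :: D) B && check D f (aPi A B) && check D a A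
      then Some (asubst1 a B) else None
  | aExt A B f g h =>
      let C := aPi A (aweak 1 B) in
      if ckT k D A && ckT k D B && ckT k D C && check D f C && check D g C
         && ckT k D (pointwise_type A B f g) && check D h (pointwise_type A B f g)
      then Some (aId C f g) else None
  | _ => None
  end
  end
with ckA (k : nat) (D : list aterm) (l X : list aterm) : bool :=
  match k with 0 => false | Datatypes.S k =>
  match l, X with
  | [], [] => true
  | a :: l, A :: X =>
      ckA k D l X &&
      match ck k D a with
      | Some T => conv k T (asubst (ainst (length D) l) A)
      | None => false
      end
  | _, _ => false
  end
  end.

Fixpoint ckctx (k : nat) (D : list aterm) : bool :=
  match D with
  | [] => true
  | A :: D => ckctx k D && ckT k D A
  end.
End Check.

Section Sound.
Variables (ax : ctx -> judgement -> Prop) (G : ctx).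
Local Notation "G ||- j" := (der ax G j) (at level 70).

Fixpoint erl (Ms : list tm) (D : list aterm) : ctx :=
  match D with
  | [] => []
  | A :: D => er Ms (length D) A :: erl Ms D
  end.

Fixpoint wf_ctx (Ms : list tm) (D : list aterm) : Prop :=
  match D with
  | [] => G ||- IsCtx
  | A :: D => wf_ctx Ms D /\ wf_type ax G Ms (length D) (erl Ms D ++ G) A
  end.

Definition realises (Ms : list tm) (m : tm) (X : list aterm) (K : option aterm) : Prop :=
  match K with
  | None => erl Ms X ++ G ||- IsType m
  | Some T =>
      wf_type ax G Ms (length X) (erl Ms X ++ G) T /\
      erl Ms X ++ G ||- HasType m (er Ms (length X) T)
  end.

Definition model (Ms : list tm) (S : signature) : Prop :=
  length Ms = length S /\
  forall i X K, nth_error S i = Some (X, K) ->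
    wf_ctx Ms X /\ exists m, nth_error Ms i = Some m /\ realises Ms m X K.

Section Ck.
Variables (Ms : list tm) (S : signature).
Hypothesis HS : model Ms S.
Local Notation wf_type := (wf_type ax G Ms).
Local Notation wf_term := (wf_term ax G Ms).
Local Notation wf_args := (wf_args ax G Ms).
Local Notation erc D := (erl Ms D ++ G).

Lemma wf_ctx_der D : wf_ctx Ms D -> erc D ||- IsCtx.
Proof.
  destruct D; cbn; auto. intros [_ H]. apply d_cons. eapply wf_type_der; eauto.
Qed.

Lemma ambient_erc D : ambient G (length D) (erc D).
Proof. induction D; cbn; [intros k; reflexivity | now apply ambient_cons]. Qed.

Lemma erl_app D1 D2 : exists P, length P = length D1 /\ erl Ms (D1 ++ D2) = P ++ erl Ms D2.
Proof.
  induction D1 as [|A D1 (P & h1 & h2)]; cbn; [exists []; auto|].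
  exists (er Ms (length (D1 ++ D2)) A :: P); cbn; rewrite h1, h2; auto.
Qed.

Lemma wf_ctx_app D1 D2 : wf_ctx Ms (D1 ++ D2) -> wf_ctx Ms D2.
Proof. induction D1; cbn; tauto. Qed.

Lemma er_weak k n A : er Ms (k + n) (aweak k A) = (er Ms n A).[shift k].
Proof.
  unfold aweak; rewrite (er_ren Ms A n) by apply ren_above_plus. tmeq.
Qed.

Lemma wf_ctx_var D i A : wf_ctx Ms D -> nth_error D i = Some A ->
  wf_type (length D) (erc D) (aweak (Datatypes.S i) A) /\
  wf_term (length D) (erc D) (aVar i) (er Ms (length D) (aweak (Datatypes.S i) A)).
Proof.
  intros HD Hi. assert (C := wf_ctx_der _ HD).
  destruct (nth_error_split _ _ Hi) as (D1 & D2 & -> & <-).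
  assert (E : D1 ++ A :: D2 = (D1 ++ [A]) ++ D2) by (rewrite <- app_assoc; reflexivity).
  destruct (erl_app D1 (A :: D2)) as (P & h1 & h2).
  apply wf_ctx_app in HD as [_ HA].
  assert (L : length (D1 ++ A :: D2) = Datatypes.S (length D1) + length D2)
    by (rewrite length_app; cbn; lia).
  cbn [erl] in h2. rewrite L. rewrite h2 in C |- *. split.
  - assert (EP : (P ++ er Ms (length D2) A :: erl Ms D2) ++ G
                 = (P ++ [er Ms (length D2) A]) ++ erc D2)
      by (rewrite <- !app_assoc; reflexivity).
    rewrite EP in *.
    replace (Datatypes.S (length D1)) with (length (P ++ [er Ms (length D2) A]))
      by (rewrite length_app, h1; cbn; lia).
    apply wf_type_wk; auto using ambient_erc.
  - rewrite er_weak. apply wf_var; auto.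
    rewrite <- app_assoc, nth_error_app2 by lia. now rewrite h1, Nat.sub_diag.
Qed.

Lemma refl_case_er n A E :
  er Ms (Datatypes.S n) (refl_case A E) =
  (er Ms (3 + n) E).[refl (var 0) .: var 0 .: var 0 .: shift 1].
Proof.
  unfold refl_case. rewrite (er_subst Ms E (3 + n)).
  - tmeq.
  - do 3 apply subst_above_cons. exact (subst_above_shift n 1).
Qed.

Lemma pair_case_er n A B C :
  er Ms (2 + n) (pair_case A B C) =
  (er Ms (Datatypes.S n) C).[tpair (var 1) (var 0) .: shift 2].
Proof.
  unfold pair_case. rewrite (er_subst Ms C (1 + n)).
  - tmeq.
  - apply subst_above_cons. exact (subst_above_shift n 2).
Qed.

Lemma er_weak2 n A : er Ms (2 + n) (aweak 2 A) = (er Ms n A).[shift 2].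
Proof. apply er_weak. Qed.

Definition ckT_ok k := forall D T, wf_ctx Ms D -> ckT S k D T = true ->
  wf_type (length D) (erc D) T.
Definition ck_ok k := forall D t T, wf_ctx Ms D -> ck S k D t = Some T ->
  wf_term (length D) (erc D) t (er Ms (length D) T) /\ wf_type (length D) (erc D) T.
Definition ckA_ok k := forall D l X, wf_ctx Ms D -> wf_ctx Ms X -> ckA S k D l X = true ->
  wf_args (length D) (erc D) l (erl Ms X) /\ length l = length X.

Lemma check_ok k D t T : ck_ok k -> wf_ctx Ms D -> wf_type (length D) (erc D) T ->
  match ck S k D t with Some T' => conv k T' T | None => false end = true ->
  wf_term (length D) (erc D) t (er Ms (length D) T).
Proof.
  intros Hk HD HT. destruct (ck S k D t) as [T'|] eqn:E; [|discriminate]. intros H.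
  destruct (Hk _ _ _ HD E) as [h1 h2].
  eapply wf_conv; [exact h1|].
  eapply conv_ok; eauto using ambient_erc. apply nf_ok.
Qed.

(** The inferred type is proved well formed along with the term, since soundness of [conv] is
    available only between two well-formed types. *)
Lemma ck_sound k : ckT_ok k /\ ck_ok k /\ ckA_ok k.
Proof.
  induction k as [|k (IT & Ik & IA)];
    [repeat split; intros *; cbn; discriminate|].
  assert (Chk := fun D t T => check_ok k D t T Ik).
  assert (Cons : forall D A, wf_ctx Ms D -> ckT S k D A = true -> wf_ctx Ms (A :: D))
    by (intros D A HD HA; split; auto).
  split; [|split].
  - intros D T HD. destruct T; cbn; try discriminate; rewrite ?andb_true_iff.
    + destruct (nth_error S i) as [[X [T|]]|] eqn:Ei; try discriminate. intros H.
      destruct (proj2 HS _ _ _ Ei) as (HX & m & Hm & Hr).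
      destruct (IA _ _ _ HD HX H) as [Hl _].
      eapply (wf_tmeta ax G Ms _ _ _ _ m (erl Ms X)); eauto using wf_ctx_der, ambient_erc.
    + intros [[h1 h2] h3]. constructor; auto.
    + intros [h1 h2]. constructor; auto. apply (IT (T1 :: D)); auto.
    + intros [h1 h2]. constructor; auto. apply (IT (T1 :: D)); auto.
  - intros D t T HD. destruct t; cbn [ck]; try discriminate.
    + destruct (nth_error D n) as [A|] eqn:Ei; [|discriminate]. cbn.
      intros [= <-]. split; now apply wf_ctx_var.
    + destruct (nth_error S i) as [[X [U|]]|] eqn:Ei; try discriminate.
      destruct (ckA S k D l X) eqn:H; [|discriminate]. intros [= <-].
      destruct (proj2 HS _ _ _ Ei) as (HX & m & Hm & HU & Hr).
      destruct (IA _ _ _ HD HX H) as [Hl El].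
      assert (Hs := wf_subst_args ax G Ms _ _ _ _ Hl (wf_ctx_der _ HD) (ambient_erc D)).
      rewrite El in Hs. split.
      * assert (Hw := wf_meta ax G Ms (length D) (erc D) i l m (erl Ms X) _ Hm Hr
          (wf_type_der _ _ _ _ _ _ HU) (wf_ctx_der _ HD) (ambient_erc D) Hl).
        eapply wf_term_eq; [exact Hw | reflexivity |].
        rewrite (er_subst Ms U (length X)) by exact (proj1 Hs).
        apply subst_ext; intros; now rewrite er_ainst.
      * eapply wf_type_subst; eauto.
    + match goal with |- (if ?b then _ else _) = _ -> _ => destruct b eqn:H end; [|discriminate].
      intros [= <-]. rewrite ?andb_true_iff in H. destruct H as [h1 h2].
      assert (HA := IT _ _ HD h1). split; constructor; auto.
    + match goal with |- (if ?b then _ else _) = _ -> _ => destruct b eqn:H end; [|discriminate].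
      intros [= <-]. rewrite ?andb_true_iff in H.
      destruct H as [[[[[[h1 h2] h3] h4] h5] h6] h7].
      assert (HA := IT _ _ HD h1). assert (HDA := Cons _ _ HD h1).
      assert (Ha := Chk _ _ _ HD HA h5). assert (Hb := Chk _ _ _ HD HA h6).
      assert (Hp := Chk _ _ (aId t1 t3 t4) HD (wf_Id _ _ _ _ _ _ _ _ HA Ha Hb) h7).
      assert (C := J_ctx _ _ _ (wf_type_der _ _ _ _ _ _ HA)).
      assert (E2 : er Ms (Datatypes.S (length D)) (aweak 1 t1) = (er Ms (length D) t1).[shift 1])
        by apply (er_weak 1).
      assert (HD2 : wf_ctx Ms (aweak 1 t1 :: t1 :: D)).
      { split; auto. apply (wf_ctx_var (t1 :: D) 0); auto. }
      assert (HD3 : wf_ctx Ms (path_ctx t1 D)).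
      { split; auto.
        pose proof (wf_ctx_var (aweak 1 t1 :: t1 :: D) 1 t1 HD2 eq_refl) as [v1 v2].
        pose proof (wf_ctx_var (aweak 1 t1 :: t1 :: D) 0 (aweak 1 t1) HD2 eq_refl) as [_ v3].
        constructor; auto.
        eapply wf_term_eq; [exact v3 | reflexivity |]. cbn [length].
        rewrite (er_weak 1), E2, (er_weak 2 (length D)). tmeq. }
      assert (HE := IT _ _ HD3 h2).
      assert (Hd := Chk _ _ _ HDA (IT _ _ HDA h3) h4).
      cbn [length path_ctx erl app] in HE, Hd. rewrite refl_case_er in Hd.
      cbn [er] in HE. rewrite E2, (er_weak2 (length D)) in HE.
      assert (Hs : wf_subst ax G Ms (3 + length D) (length D)
                (acons t5 (acons t4 (acons t3 (ashift 0))))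
                (Id (er Ms (length D) t1).[shift 2] (var 1) (var 0)
                 :: (er Ms (length D) t1).[shift 1] :: er Ms (length D) t1 :: erc D) (erc D)).
      { apply wf_subst_cons with (m := length D);
        [apply wf_subst_cons; [apply wf_subst_cons; [apply wf_subst_id|]|]|];
        auto using ambient_erc, wf_ctx_der;
        (eapply wf_term_eq; [eassumption | reflexivity | tmeq]). }
      split.
      * eapply wf_term_eq; [apply wf_J; eauto | reflexivity |].
        rewrite (er_subst Ms t2 (3 + length D)) by exact (proj1 Hs). tmeq.
      * eapply wf_type_subst; eauto.
    + match goal with |- (if ?b then _ else _) = _ -> _ => destruct b eqn:H end; [|discriminate].
      intros [= <-]. rewrite ?andb_true_iff in H. destruct H as [[[h1 h2] h3] h4].
      assert (HA := IT _ _ HD h1). assert (HB := IT _ _ (Cons _ _ HD h1) h2).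
      assert (Ha := Chk _ _ _ HD HA h3).
      assert (HBa := wf_type_subst1 _ _ _ _ _ _ _ _ HB Ha (ambient_erc D)).
      assert (Hb := Chk _ _ _ HD HBa h4).
      split; [|now constructor]. apply wf_pair; auto.
      now rewrite <- er_subst1.
    + match goal with |- (if ?b then _ else _) = _ -> _ => destruct b eqn:H end; [|discriminate].
      intros [= <-]. rewrite ?andb_true_iff in H.
      destruct H as [[[[[h1 h2] h3] h4] h5] h6].
      assert (HA := IT _ _ HD h1). assert (HDA := Cons _ _ HD h1).
      assert (HB := IT _ _ HDA h2). assert (HDB := Cons _ _ HDA h2).
      assert (HSg : wf_type (length D) (erc D) (aSig t1 t2)) by now constructor.
      assert (HDS : wf_ctx Ms (aSig t1 t2 :: D)) by (split; auto).
      assert (HC := IT _ _ HDS h3).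
      assert (He := Chk _ _ _ HD HSg h4).
      assert (Hd := Chk _ _ _ HDB (IT _ _ HDB h5) h6).
      change (length (t2 :: t1 :: D)) with (2 + length D) in Hd.
      rewrite pair_case_er in Hd.
      split.
      * eapply wf_term_eq; [apply wf_split; eauto | reflexivity |].
        symmetry; apply er_subst1.
      * eapply wf_type_subst1; eauto using ambient_erc. exact HC.
    + match goal with |- (if ?b then _ else _) = _ -> _ => destruct b eqn:H end; [|discriminate].
      intros [= <-]. rewrite ?andb_true_iff in H. destruct H as [[h1 h2] h3].
      assert (HA := IT _ _ HD h1). assert (HDA := Cons _ _ HD h1).
      assert (HB := IT _ _ HDA h2). assert (Hb := Chk _ _ _ HDA HB h3).
      split; constructor; auto.
    + match goal with |- (if ?b then _ else _) = _ -> _ => destruct b eqn:H end; [|discriminate].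
      intros [= <-]. rewrite ?andb_true_iff in H. destruct H as [[[h1 h2] h3] h4].
      assert (HA := IT _ _ HD h1). assert (HDA := Cons _ _ HD h1).
      assert (HB := IT _ _ HDA h2).
      assert (Hf := Chk _ _ (aPi t1 t2) HD (wf_Pi _ _ _ _ _ _ _ HA HB) h3).
      assert (Ha := Chk _ _ _ HD HA h4).
      split.
      * unfold asubst1; rewrite er_subst1. constructor; auto.
      * eapply wf_type_subst1; eauto using ambient_erc. exact HB.
    + cbv zeta.
      match goal with |- (if ?b then _ else _) = _ -> _ => destruct b eqn:H end; [|discriminate].
      intros [= <-]. rewrite ?andb_true_iff in H.
      destruct H as [[[[[[h1 h2] h3] h4] h5] h6] h7].
      assert (HA := IT _ _ HD h1). assert (HB := IT _ _ HD h2).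
      assert (HC := IT _ _ HD h3).
      assert (Hf := Chk _ _ _ HD HC h4). assert (Hg := Chk _ _ _ HD HC h5).
      assert (Hh := Chk _ _ _ HD (IT _ _ HD h6) h7).
      assert (EC : er Ms (length D) (aPi t1 (aweak 1 t2)) =
                   arr (er Ms (length D) t1) (er Ms (length D) t2)).
      { cbn. unfold arr. f_equal. apply (er_weak 1). }
      split; [|constructor; auto].
      cbn [er]. cbn [er] in EC. rewrite EC. cbn [er] in Hf, Hg. rewrite EC in Hf, Hg.
      apply wf_ext; auto.
      eapply wf_term_eq; [exact Hh | reflexivity |].
      cbn [er pointwise_type].
      rewrite !(er_weak 1). reflexivity.
  - intros D l X HD HX. destruct l as [|a l], X as [|A X]; cbn; try discriminate.
    + split; [constructor | reflexivity].
    + rewrite andb_true_iff; intros [h1 h2]. destruct HX as [HX HA].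
      destruct (IA _ _ _ HD HX h1) as [Hl El].
      assert (Hs := wf_subst_args ax G Ms _ _ _ _ Hl (wf_ctx_der _ HD) (ambient_erc D)).
      rewrite El in Hs.
      split; [|cbn; congruence]. constructor; auto.
      eapply wf_term_eq; [apply Chk; [exact HD | eapply wf_type_subst; eauto | exact h2]
                         | reflexivity |].
      rewrite (er_subst Ms A (length X)) by exact (proj1 Hs).
      apply subst_ext; intros; now rewrite er_ainst.
Qed.

Lemma ckctx_sound k D : G ||- IsCtx -> ckctx S k D = true -> wf_ctx Ms D.
Proof.
  intros HG; induction D as [|A D IH]; cbn; auto.
  rewrite andb_true_iff; intros [h1 h2]. split; auto. apply (ck_sound k); auto.
Qed.

End Ck.
End Sound.

(** * Elaboration *)

Section Mono.
Variables (ax : ctx -> judgement -> Prop) (G : ctx) (Ms Ns : list tm).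
Local Notation "G ||- j" := (der ax G j) (at level 70).

(** New realisers can only affect a symbol whose index lies outside [Ms], where erasure falls back
    on a default; well-formed syntax contains none. *)
Lemma wf_mono :
  (forall n D T, wf_type ax G Ms n D T ->
     er (Ms ++ Ns) n T = er Ms n T /\ wf_type ax G (Ms ++ Ns) n D T) /\
  (forall n D t T, wf_term ax G Ms n D t T ->
     er (Ms ++ Ns) n t = er Ms n t /\ wf_term ax G (Ms ++ Ns) n D t T) /\
  (forall n D l T, wf_args ax G Ms n D l T ->
     map (er (Ms ++ Ns) n) l = map (er Ms n) l /\ wf_args ax G (Ms ++ Ns) n D l T).
Proof.
  assert (N : forall i m, nth_error Ms i = Some m -> nth_error (Ms ++ Ns) i = Some m).
  { intros i m H. rewrite nth_error_app1; auto. apply nth_error_Some; congruence. }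
  apply wf_ind; intros;
    repeat match goal with
    | H : _ /\ _ |- _ => destruct H
    | H : nth_error Ms ?i = Some _ |- _ =>
        lazymatch goal with
        | _ : nth_error (Ms ++ Ns) i = Some _ |- _ => fail
        | _ => pose proof (N _ _ H); pose proof (nth_of_error _ _ _ H);
               pose proof (nth_of_error _ _ _ (N _ _ H))
        end
    end;
    (split; [cbn; try congruence|]);
    try solve [econstructor; eauto];
    try match goal with
    | H : map (er (Ms ++ Ns) _) _ = _ |- wf_term _ _ _ _ _ (aMeta _ _) _ =>
        rewrite <- H; eapply wf_meta; eauto
    | H : map (er (Ms ++ Ns) _) _ = _ |- wf_args _ _ _ _ _ _ _ =>
        constructor; auto; now rewrite H
    end;
    repeat match goal with
    | H : er (Ms ++ Ns) ?n ?t = er Ms ?n ?t |- _ => rewrite <- H in *; clear H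
    end; try (constructor; auto; fail).
Qed.

Lemma erl_mono D : wf_ctx ax G Ms D ->
  erl (Ms ++ Ns) D = erl Ms D /\ wf_ctx ax G (Ms ++ Ns) D.
Proof.
  induction D as [|A D IH]; cbn; auto. intros [h1 h2].
  destruct (IH h1) as [h3 h4], (proj1 wf_mono _ _ _ h2) as [h5 h6].
  rewrite h3, h5; auto.
Qed.

Lemma realises_mono m X K : wf_ctx ax G Ms X ->
  realises ax G Ms m X K -> realises ax G (Ms ++ Ns) m X K.
Proof.
  intros HX. destruct (erl_mono X HX) as [E _]. unfold realises. rewrite E.
  destruct K as [T|]; auto. intros [h1 h2].
  destruct (proj1 wf_mono _ _ _ h1) as [h3 h4]. rewrite h3; auto.
Qed.

End Mono.

Lemma model_app ax G Ms Sg m X K : model ax G Ms Sg ->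
  wf_ctx ax G Ms X -> realises ax G Ms m X K ->
  model ax G (Ms ++ [m]) (Sg ++ [(X, K)]).
Proof.
  intros [L H] HX Hm. split; [rewrite !length_app; cbn; congruence|].
  intros i Y K' Hi. destruct (Nat.lt_ge_cases i (length Sg)) as [Li|Li].
  - rewrite nth_error_app1 in Hi by auto. destruct (H _ _ _ Hi) as (HY & m' & h1 & h2).
    split; [now apply erl_mono|]. exists m'; split; [|now apply realises_mono].
    rewrite nth_error_app1; congruence.
  - rewrite nth_error_app2 in Hi |- * by congruence. rewrite L.
    destruct (i - length Sg) as [|[|j]]; try discriminate.
    injection Hi as <- <-. split; [now apply erl_mono|].
    exists m; split; [reflexivity | now apply realises_mono].
Qed.

(* Binders range over de Bruijn levels, and the arguments of [sMeta] are listed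
   oldest variable first. *)
Inductive stm : Type :=
| sVar (level : nat)
| sMeta (i : nat) (l : list stm)
| sId (A a b : stm)
| sRefl
| sJ (p : stm) (E : nat -> nat -> nat -> stm) (d : nat -> stm)
| sSig (A : stm) (B : nat -> stm)
| sPair (a b : stm)
| sSplit (e : stm) (C : nat -> stm) (d : nat -> nat -> stm)
| sP1 (e : stm)
| sP2 (e : stm)
| sPi (A : stm) (B : nat -> stm)
| sLam (b : nat -> stm)
| sApp (f a : stm)
| sExt (A B f g h : stm)
| sAnn (t T : stm).

Definition bind {A B} (x : option A) (f : A -> option B) : option B :=
  match x with Some a => f a | None => None end.
Local Notation "'do' x <- e ; f" := (bind e (fun x => f))
  (at level 200, x pattern, e at level 100, f at level 200).

Definition aP1 (A B e : aterm) : aterm := aSplit A B (aweak 1 A) e (aVar 1).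
Definition aP2 (A B e : aterm) : aterm :=
  aSplit A B
    (asubst (acons (aP1 (aweak 1 A) (aren (upr S) B) (aVar 0)) (ashift 1)) B) e (aVar 0).

Section Elab.
Variable Sg : signature.

(** Bidirectional and without normalisation: [elI] requires an inferred type to show its head
    already, and [elC] leaves the comparison of inferred and expected type to the checker. *)
Fixpoint elT (k : nat) (D : list aterm) (t : stm) : option aterm :=
  match k with 0 => None | S k =>
  let n := length D in
  match t with
  | sMeta i l =>
      do X <- nth_error Sg i ;
      do l' <- elA k D [] l (rev (fst X)) ;
      Some (aMeta i l')
  | sId A a b =>
      do A' <- elT k D A ; do a' <- elC k D a A' ; do b' <- elC k D b A' ; Some (aId A' a' b')
  | sSig A B => do A' <- elT k D A ; do B' <- elT k (A' :: D) (B n) ; Some (aSig A' B')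
  | sPi A B => do A' <- elT k D A ; do B' <- elT k (A' :: D) (B n) ; Some (aPi A' B')
  | _ => None
  end
  end
with elI (k : nat) (D : list aterm) (t : stm) : option (aterm * aterm) :=
  match k with 0 => None | S k =>
  let n := length D in
  match t with
  | sVar l =>
      let i := n - S l in
      do A <- nth_error D i ; Some (aVar i, aweak (S i) A)
  | sMeta i l =>
      do X <- nth_error Sg i ;
      do T <- snd X ;
      do l' <- elA k D [] l (rev (fst X)) ;
      Some (aMeta i l', asubst (ainst n l') T)
  | sJ p E d =>
      do (p', T) <- elI k D p ;
      match T with
      | aId A a b =>
          do E' <- elT k (path_ctx A D) (E n (S n) (S (S n))) ;
          do d' <- elC k (A :: D) (d n) (refl_case A E') ;
          Some (aJ A E' a b p' d',
                asubst (acons p' (acons b (acons a (ashift 0)))) E')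
      | _ => None
      end
  | sSplit e C d =>
      do (e', T) <- elI k D e ;
      match T with
      | aSig A B =>
          do C' <- elT k (T :: D) (C n) ;
          do d' <- elC k (B :: A :: D) (d n (S n)) (pair_case A B C') ;
          Some (aSplit A B C' e' d', asubst1 e' C')
      | _ => None
      end
  | sP1 e =>
      do (e', T) <- elI k D e ;
      match T with aSig A B => Some (aP1 A B e', A) | _ => None end
  | sP2 e =>
      do (e', T) <- elI k D e ;
      match T with
      | aSig A B => Some (aP2 A B e', asubst1 (aP1 A B e') B)
      | _ => None
      end
  | sApp f a =>
      do (f', T) <- elI k D f ;
      match T with
      | aPi A B => do a' <- elC k D a A ; Some (aApp A B f' a', asubst1 a' B)
      | _ => None
      end
  | sExt A B f g h =>
      do A' <- elT k D A ; do B' <- elT k D B ;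
      let C := aPi A' (aweak 1 B') in
      do f' <- elC k D f C ; do g' <- elC k D g C ;
      do h' <- elC k D h (pointwise_type A' B' f' g') ;
      Some (aExt A' B' f' g' h', aId C f' g')
  | sAnn t T => do T' <- elT k D T ; do t' <- elC k D t T' ; Some (t', T')
  | _ => None
  end
  end
with elC (k : nat) (D : list aterm) (t : stm) (T : aterm) : option aterm :=
  match k with 0 => None | S k =>
  match t, T with
  | sRefl, aId A a _ => Some (aRefl A a)
  | sLam b, aPi A B => do b' <- elC k (A :: D) (b (length D)) B ; Some (aLam A B b')
  | sPair a b, aSig A B =>
      do a' <- elC k D a A ; do b' <- elC k D b (asubst1 a' B) ; Some (aPair A B a' b')
  | _, _ => do (t', _) <- elI k D t ; Some t'
  end
  end
with elA (k : nat) (D acc : list aterm) (l : list stm) (X : list aterm)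
    : option (list aterm) :=
  match k with 0 => None | S k =>
  match l, X with
  | [], _ => Some acc
  | a :: l, A :: X =>
      do a' <- elC k D a (asubst (ainst (length D) acc) A) ; elA k D (a' :: acc) l X
  | _, _ => None
  end
  end.

(** [dVar] builds the telescope. [dType] and [dTerm] introduce symbols whose realisers are supplied
    from outside; [dDef] is realised by erasing its body, [dPath] by [has_paths]. *)
Inductive decl : Type :=
| dVar (A : stm) (f : nat -> decl)
| dType
| dTerm (T : stm)
| dDef (T t : stm)
| dPath (X : stm) (Y a b h : nat -> stm).

Inductive item : Type :=
| iType
| iTerm (T : aterm)
| iDef (T t : aterm)
| iPath (X Y a b h : aterm).

Fixpoint elD (k : nat) (D : list aterm) (d : decl) : option (list aterm * item) :=
  let n := length D in
  match d with
  | dVar A f => do A' <- elT k D A ; elD k (A' :: D) (f n)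
  | dType => Some (D, iType)
  | dTerm T => do T' <- elT k D T ; Some (D, iTerm T')
  | dDef T t => do T' <- elT k D T ; do t' <- elC k D t T' ; Some (D, iDef T' t')
  | dPath X Y a b h =>
      do X' <- elT k D X ; do Y' <- elT k (X' :: D) (Y n) ;
      do a' <- elC k (X' :: D) (a n) Y' ; do b' <- elC k (X' :: D) (b n) Y' ;
      do h' <- elC k (X' :: D) (h n) (aId Y' a' b') ;
      Some (D, iPath X' Y' a' b' h')
  end.

(* The path between [x |-> (a x, refl)] and [x |-> (b x, h x)] in the product of
   the spaces of paths starting at [a x]. *)
Definition path_type (X Y a b h : aterm) : aterm :=
  let I := aId (aweak 1 Y) (aweak 1 a) (aVar 0) in
  let S := aSig Y I in
  aId (aPi X S) (aLam X S (aPair Y I a (aRefl Y a))) (aLam X S (aPair Y I b h)).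

Definition item_type (i : item) : option aterm :=
  match i with
  | iType => None
  | iTerm T | iDef T _ => Some T
  | iPath X Y a b h => Some (path_type X Y a b h)
  end.

Definition fuel : nat := Eval vm_compute in 1000.

Definition check (D : list aterm) (t T : aterm) : bool :=
  match ck Sg fuel D t with Some T' => conv fuel T' T | None => false end.

Definition check_item (D : list aterm) (i : item) : bool :=
  ckctx Sg fuel D &&
  match item_type i with None => true | Some T => ckT Sg fuel D T end &&
  match i with
  | iType | iTerm _ => true
  | iDef T t => check D t T
  | iPath X Y a b h =>
      ckT Sg fuel D X && ckT Sg fuel (X :: D) Y && check (X :: D) a Y
      && check (X :: D) b Y && ckT Sg fuel (X :: D) (aId Y a b)
      && check (X :: D) h (aId Y a b)
  end.

(* The elaborator is not trusted: its output is checked again. *)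
Definition entry (d : decl) : option (list aterm * item) :=
  do (D, i) <- elD fuel [] d ;
  if check_item D i then Some (D, i) else None.
End Elab.

(* Without [paths], [run] serves to prove [has_paths]. *)
Definition defines (paths : bool) (i : item) : bool :=
  match i with iDef _ _ => true | iPath _ _ _ _ _ => paths | _ => false end.

Fixpoint run (paths : bool) (Sg : signature) (ds : list decl) : option signature :=
  match ds with
  | [] => Some Sg
  | d :: ds =>
      do (D, i) <- entry Sg d ;
      if defines paths i then run paths (Sg ++ [(D, item_type i)]) ds else None
  end.

Definition last_entry (Sg : option signature) : option (list aterm * aterm) :=
  match Sg with
  | Some Sg => match rev Sg with (D, Some T) :: _ => Some (D, T) | _ => None end
  | None => None
  end.

(** The homotopy travels with the function, so transport along this path moves statements about a
    function and a homotopy together: this is homotopy induction. *)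
Definition has_paths (ax : ctx -> judgement -> Prop) : Prop := forall G X Y a b h,
  der ax G (IsType X) -> der ax (X :: G) (IsType Y) ->
  der ax (X :: G) (HasType a Y) -> der ax (X :: G) (HasType b Y) ->
  der ax (X :: G) (HasType h (Id Y a b)) ->
  inhabited ax G
    (Id (Pi X (Sig Y (Id Y.[shift 1] a.[shift 1] (var 0))))
        (lam (tpair a (refl a))) (lam (tpair b h))).

Local Opaque fuel.

(** * Soundness of running a list of declarations *)

Section Run.
Variables (ax : ctx -> judgement -> Prop) (G : ctx).
Hypothesis HG : der ax G IsCtx.
Local Notation "G ||- j" := (der ax G j) (at level 70).

Lemma check_sound Ms Sg D t T : model ax G Ms Sg -> wf_ctx ax G Ms D ->
  wf_type ax G Ms (length D) (erl Ms D ++ G) T -> check Sg D t T = true ->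
  wf_term ax G Ms (length D) (erl Ms D ++ G) t (er Ms (length D) T).
Proof.
  unfold check; generalize fuel; intros k HM HD HT.
  apply (check_ok ax G Ms Sg); auto. apply (ck_sound ax G Ms Sg); auto.
Qed.

Lemma entry_sound Ms Sg d D i : model ax G Ms Sg -> entry Sg d = Some (D, i) ->
  wf_ctx ax G Ms D /\
  (forall T, item_type i = Some T -> wf_type ax G Ms (length D) (erl Ms D ++ G) T) /\
  check_item Sg D i = true.
Proof.
  intros HM; unfold entry. destruct (elD Sg fuel [] d) as [[D' i']|]; [|discriminate].
  cbn [bind]. destruct (check_item Sg D' i') eqn:H; [|discriminate].
  intros [= -> ->]. assert (H' := H). unfold check_item in H'.
  rewrite !andb_true_iff in H'. destruct H' as [[h1 h2] _].
  assert (HD := ckctx_sound ax G Ms Sg HM fuel D HG h1). split; [|split]; auto.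
  intros T E; rewrite E in h2. apply (ck_sound ax G Ms Sg HM fuel); auto.
Qed.

Lemma def_sound Ms Sg d D T t : model ax G Ms Sg -> entry Sg d = Some (D, iDef T t) ->
  erl Ms D ++ G ||- HasType (er Ms (length D) t) (er Ms (length D) T).
Proof.
  intros HM He. destruct (entry_sound _ _ _ _ _ HM He) as (HD & HT & Hc).
  unfold check_item in Hc. rewrite !andb_true_iff in Hc.
  eapply wf_term_der, check_sound; eauto. apply Hc.
Qed.

Lemma model_nil : model ax G [] [].
Proof. split; auto. intros [|]; discriminate. Qed.

Lemma model_type Ms Sg d D m : model ax G Ms Sg -> entry Sg d = Some (D, iType) ->
  erl Ms D ++ G ||- IsType m -> model ax G (Ms ++ [m]) (Sg ++ [(D, None)]).
Proof.
  intros HM He Hm. destruct (entry_sound _ _ _ _ _ HM He) as (HD & _).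
  eapply model_app; eauto.
Qed.

Lemma model_term Ms Sg d D i T m : model ax G Ms Sg -> entry Sg d = Some (D, i) ->
  item_type i = Some T ->
  erl Ms D ++ G ||- HasType m (er Ms (length D) T) ->
  model ax G (Ms ++ [m]) (Sg ++ [(D, Some T)]).
Proof.
  intros HM He Hi Hm. destruct (entry_sound _ _ _ _ _ HM He) as (HD & HT & _).
  eapply model_app; eauto. split; auto.
Qed.
Lemma model_def Ms Sg d D T t : model ax G Ms Sg -> entry Sg d = Some (D, iDef T t) ->
  exists m, model ax G (Ms ++ [m]) (Sg ++ [(D, Some T)]).
Proof. intros HM He. eexists; eapply model_term; eauto using def_sound. Qed.

Lemma path_type_er Ms n X Y a b h :
  er Ms n (path_type X Y a b h) =
  Id (Pi (er Ms n X) (Sig (er Ms (S n) Y)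
       (Id (er Ms (S n) Y).[shift 1] (er Ms (S n) a).[shift 1] (var 0))))
     (lam (tpair (er Ms (S n) a) (refl (er Ms (S n) a))))
     (lam (tpair (er Ms (S n) b) (er Ms (S n) h))).
Proof.
  cbn. rewrite !(er_weak Ms 1 (S n)). reflexivity.
Qed.

Lemma path_sound Ms Sg d D X Y a b h : has_paths ax -> model ax G Ms Sg ->
  entry Sg d = Some (D, iPath X Y a b h) ->
  inhabited ax (erl Ms D ++ G) (er Ms (length D) (path_type X Y a b h)).
Proof.
  intros HP HM He. destruct (entry_sound _ _ _ _ _ HM He) as (HD & _ & Hc).
  unfold check_item in Hc. rewrite !andb_true_iff in Hc.
  destruct Hc as [_ [[[[[hX hY] ha] hb] hI] hh]].
  destruct (ck_sound ax G Ms Sg HM fuel) as [IT _].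
  assert (HX := IT _ _ HD hX). assert (HXD : wf_ctx ax G Ms (X :: D)) by (split; auto).
  assert (HY := IT _ _ HXD hY).
  rewrite path_type_er. apply HP; try (eapply wf_type_der; eauto; fail);
    apply (wf_term_der ax G Ms).
  - apply (check_sound Ms Sg (X :: D) a Y); auto.
  - apply (check_sound Ms Sg (X :: D) b Y); auto.
  - apply (check_sound Ms Sg (X :: D) h (aId Y a b)); auto.
Qed.

Lemma run_sound paths : (paths = true -> has_paths ax) ->
  forall ds Ms Sg Sg', model ax G Ms Sg -> run paths Sg ds = Some Sg' ->
  exists Ns, model ax G (Ms ++ Ns) Sg'.
Proof.
  intros HP ds; induction ds as [|d ds IH]; intros Ms Sg Sg' HM; cbn.
  - intros [= <-]. exists []. now rewrite app_nil_r.
  - destruct (entry Sg d) as [[D i]|] eqn:He; [|discriminate]. cbn [bind].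
    destruct (defines paths i) eqn:Hi; [|discriminate]. intros HR.
    assert (H : exists T m, item_type i = Some T /\
                erl Ms D ++ G ||- HasType m (er Ms (length D) T)).
    { destruct i as [| |T t|X Y a b h]; try discriminate.
      - exists T, (er Ms (length D) t); split; auto. eapply def_sound; eauto.
      - destruct (path_sound _ _ _ _ _ _ _ _ _ (HP Hi) HM He) as [m Hm].
        exists (path_type X Y a b h), m; auto. }
    destruct H as (T & m & ET & Hm). rewrite ET in HR.
    destruct (IH (Ms ++ [m]) _ _ (model_term _ _ _ _ _ _ _ HM He ET Hm) HR) as [Ns HN].
    exists (m :: Ns). now rewrite <- app_assoc in HN.
Qed.

Lemma run_last paths ds Ms Sg D T : (paths = true -> has_paths ax) ->
  model ax G Ms Sg -> last_entry (run paths Sg ds) = Some (D, T) ->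
  exists Ns t, erl (Ms ++ Ns) D ++ G ||- HasType t (er (Ms ++ Ns) (length D) T).
Proof.
  intros HP HM. destruct (run paths Sg ds) as [Sg'|] eqn:HR; [|discriminate].
  destruct (run_sound paths HP _ _ _ _ HM HR) as (Ns & _ & HN). cbn.
  destruct (rev Sg') as [|[D' [T'|]] S] eqn:E; try discriminate. intros [= -> ->].
  assert (E' : Sg' = rev S ++ [(D, Some T)])
    by (rewrite <- (rev_involutive Sg'), E; reflexivity).
  destruct (HN (length (rev S)) D (Some T)) as (_ & m & _ & _ & Hm).
  - now rewrite E', nth_error_app2, Nat.sub_diag by auto.
  - eauto.
Qed.
End Run.

(** * Function extensionality *)

Coercion sVar : nat >-> stm.
Definition sArr (A B : stm) : stm := sPi A (fun _ => B).

(** J on [p] alone: composing with reflexivity on the left reduces, on the right it does not, and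
    [c] is the right endpoint of [q]. *)
Definition sTrans (A c p q : stm) : stm :=
  sApp (sJ p (fun x y _ => sArr (sId A y c) (sId A x c)) (fun x => sLam (fun r => r))) q.
Definition sSym (A p : stm) : stm :=
  sJ p (fun x y _ => sId A y x) (fun x => sRefl).
Definition sAp (B : stm) (f : stm -> stm) (p : stm) : stm :=
  sJ p (fun x y _ => sId B (f x) (f y)) (fun x => sRefl).
Definition sTr (C : stm -> stm) (p a : stm) : stm :=
  sApp (sJ p (fun x y _ => sArr (C x) (C y)) (fun x => sLam (fun a => a))) a.
Definition sHapp (B p z : stm) : stm := sAp B (fun f => sApp f z) p.

Definition sCancel (A p : stm) : stm :=
  sJ p (fun x y p =>
          let r := sAnn sRefl (sId A y y) in
          sId (sId A y y) (sTrans A y (sSym A p) (sTrans A y p r)) sRefl)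
       (fun x => sRefl).

Section WeakFunext.
Variables (X : stm) (S : stm -> stm) (a b : stm -> stm) (k : stm -> stm -> stm).

Let T := sSig X (fun x => S x).
Let Prod := sPi X (fun x => S x).
Let F := sArr X T.
Let XX := sArr X X.
Let psi (x : stm) := sAnn (sPair x (a x)) T.
Let L (t : stm) := sAnn (sLam (fun x => sP1 (sApp t x))) XX.
Let N (t : stm) := sAnn (sLam (fun x => psi (sP1 (sApp t x)))) F.
Let eps (t : stm) :=
  sExt X T t (N t) (sLam (fun x =>
    sSplit (sApp t x) (fun z => sId T z (psi (sP1 z)))
      (fun x s => sAp T (fun s => sAnn (sPair x s) T) (k x s)))).
Let i := sAnn (sLam (fun x => x)) XX.
(** For [t] with [q : L t = i], transport along [q] turns the second components of [t] into a
    section of [S], which is claimed equal to [a]. At reflexivity this reduces to the goal for [bs],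
    and to an instance of reflexivity for [as_]. *)
Let U (t q : stm) :=
  sId Prod (sLam (fun x => a x)) (sLam (fun x => sTr S (sHapp X q x) (sP2 (sApp t x)))).
Let as_ := sAnn (sLam (fun x => psi x)) F.
Let bs := sAnn (sLam (fun x => sPair x (b x))) F.
Let Leps (t : stm) := sAp XX L (eps t).
Let inv_i (t q : stm) := sTrans XX i (sSym XX (Leps t)) q.

Definition sWeakFunext : stm :=
  (* Moving along [eps as_] ends at [N as_], which reduces to [as_] again, but now over the inverse
     of the loop [Leps as_]. *)
  let step1 :=
    sApp (sApp
      (sJ (eps as_)
         (fun t t' e => sPi (sId XX (L t) i) (fun q =>
            sArr (U t q) (U t' (sTrans XX i (sSym XX (sAp XX L e)) q))))
         (fun t => sLam (fun q => sLam (fun u => u))))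
      sRefl) sRefl in
  (* [N bs] reduces to [as_] as well. Naturality is built into the motive: going back from [t'] to
     [t] trades the loop of [t'] for that of [t], which is trivial when the path is refl, so no
     equation between loops has to be stated. *)
  let step2 :=
    sApp (sApp
      (sJ (eps bs)
         (fun t t' e => sPi (sId XX (L t') i) (fun q =>
            sArr (U t' (inv_i t' q))
                 (U t (sTrans XX i (sSym XX (Leps t)) (sTrans XX i (sAp XX L e) q)))))
         (fun t => sLam (fun q => sLam (fun u => u))))
      sRefl) step1 in
  (* Over [bs] the loop meets its own inverse; cancelling leaves reflexivity. *)
  sTr (fun q => U bs q) (sCancel XX (Leps bs)) step2.
End WeakFunext.

Definition sSing (Y u : stm) : stm := sSig Y (fun y => sId Y u y).
Definition sSing_contr (Y u s : stm) : stm :=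
  sSplit s (fun s => sId (sSing Y u) s (sPair u sRefl))
    (fun y p => sJ p (fun u y p => sId (sSing Y u) (sPair y p) (sPair u sRefl))
                     (fun u => sRefl)).

Definition decl_at (l : list decl) (n : nat) : decl := nth n l dType.

Module Homotopy_path.
Definition X : stm := sMeta 0 [].
Definition Y (x : stm) : stm := sMeta 1 [x].
Definition a (x : stm) : stm := sMeta 2 [x].
Definition b (x : stm) : stm := sMeta 3 [x].
Definition h (x : stm) : stm := sMeta 4 [x].
Definition S (x : stm) : stm := sSing (Y x) (a x).
Definition base : list decl :=
  [ dType; dVar X (fun _ => dType);
    dVar X (fun x => dTerm (Y x)); dVar X (fun x => dTerm (Y x));
    dVar X (fun x => dTerm (sId (Y x) (a x) (b x))) ].
Definition contr_decl : decl :=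
  dVar X (fun x => dVar (S x) (fun s =>
    dDef (sId (S x) s (sPair (a x) sRefl)) (sSing_contr (Y x) (a x) s))).
Definition path_decl : decl :=
  let sa x := sAnn (sPair (a x) sRefl) (S x) in
  let sb x := sAnn (sPair (b x) (h x)) (S x) in
  dDef (sId (sPi X (fun x => S x)) (sLam (fun x => sa x)) (sLam (fun x => sb x)))
    (sWeakFunext X S sa sb (fun x s => sMeta 5 [x; s])).
End Homotopy_path.

Ltac raw_eq :=
  unfold contr, Alg_hom, Pmap, P, W_ctx, alg_of_sup, sup_of_alg, arr, comp; cbn; tmeq.
Ltac der_by H := eapply der_eq; [exact H | raw_eq | raw_eq].
(** The declaration is checked by computation on a closed signature; what remains is the derivation
    for the raw realiser. *)
Ltac add_type HG d t H :=
  eapply (model_type _ _ HG _ _ d _ t) in H; [|vm_compute; reflexivity | ].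
Ltac add_term HG d t H :=
  eapply (model_term _ _ HG _ _ d _ _ _ t) in H; [|vm_compute; reflexivity | reflexivity | ].

(** The space of paths starting at [a x] is contractible for each [x], so weak function
    extensionality equates the section of centres with the section given by [b] and [h]. *)
Lemma homotopy_path ax : has_paths ax.
Proof.
  intros G X Y a b h HX HY Ha Hb Hh. assert (HG := der_ctx _ _ _ HX).
  assert (HM := model_nil ax G).
  add_type HG (decl_at Homotopy_path.base 0) X HM; [|der_by HX].
  add_type HG (decl_at Homotopy_path.base 1) Y HM; [|der_by HY].
  add_term HG (decl_at Homotopy_path.base 2) a HM; [|der_by Ha].
  add_term HG (decl_at Homotopy_path.base 3) b HM; [|der_by Hb].
  add_term HG (decl_at Homotopy_path.base 4) h HM; [|der_by Hh].
  destruct (run_last ax G HG false [Homotopy_path.contr_decl; Homotopy_path.path_decl]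
              _ _ _ _ ltac:(discriminate) HM ltac:(vm_compute; reflexivity)) as (Ns & t & Ht).
  exists t. der_by Ht.
Qed.

(** * Homotopy induction and normalised function extensionality *)

Definition sPairAt (x y A : stm) (B : nat -> stm) : stm := sAnn (sPair x y) (sSig A B).
Definition sFun (A : stm) (B b : stm -> stm) : stm :=
  sAnn (sLam (fun x => b x)) (sPi A (fun x => B x)).

(* Homotopy induction: [Q g h] holds for all [g] and all pointwise paths [h]
   from [a] to [g] as soon as it holds for [a] and the constant paths; [path]
   is the result of a [dPath]. *)
Definition sHind (X : stm) (Y a : stm -> stm) (path : stm)
    (Q : stm -> stm -> stm) (q : stm) : stm :=
  sTr (fun s => Q (sFun X Y (fun x => sP1 (sApp s x)))
                  (sFun X (fun x => sId (Y x) (a x) (sP1 (sApp s x)))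
                     (fun x => sP2 (sApp s x))))
      path q.

(* Normalised so that [FE f f refl] is equal to [refl]. *)
Definition sFE (A B f g h : stm) : stm :=
  sTrans (sArr A B) g (sSym (sArr A B) (sExt A B f f (sLam (fun z => sRefl)))) (sExt A B f g h).
Definition sFErefl (A B f : stm) : stm :=
  let C := sArr A B in
  sJ (sExt A B f f (sLam (fun z => sRefl)))
    (fun x y p => sId (sId C y y) (sTrans C y (sSym C p) p) sRefl) (fun x => sRefl).

(* [FE] at the identity homotopy gives a path from [u] to its eta-expansion. *)
Definition sEta (A B u : stm) : stm :=
  sFE A B u (sLam (fun y => sApp u y)) (sLam (fun y => sRefl)).

Definition sPwEq (A B f g p q : stm) : stm :=
  sPi A (fun z => sId (sId B (sApp f z) (sApp g z)) (sHapp B p z) (sHapp B q z)).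

(* The last declaration: pointwise equal paths between functions are equal.
   [i] is the index that the first one gets in the signature. *)
Definition path_eq_decls (i : nat) (A B : stm) : list decl :=
  let C := sArr A B in
  let Y (f g : stm) (z : stm) := sId B (sApp f z) (sApp g z) in
  let H f g := sPi A (fun z => Y f g z) in
  let tele (c : nat -> nat -> nat -> nat -> nat -> decl) :=
    dVar C (fun f => dVar C (fun g => dVar (H f g) (fun h => dVar (H f g) (fun k =>
      dVar (sPi A (fun z => sId (Y f g z) (sApp h z) (sApp k z))) (fun l => c f g h k l))))) in
  let FE f g h := sFE A B f g (sFun A (Y f g) (fun z => sApp h z)) in
  [ tele (fun f g h k l =>
      dPath A (fun z => Y f g z) (fun z => sApp h z) (fun z => sApp k z) (fun z => sApp l z));
    tele (fun f g h k l =>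
      dDef (sId (sId C f g) (FE f g h) (FE f g k))
        (sHind A (Y f g) (fun z => sApp h z) (sMeta i [sVar f; sVar g; sVar h; sVar k; sVar l])
           (fun k _ => sId (sId C f g) (FE f g h) (sFE A B f g k)) sRefl));
    dVar C (fun f => dVar C (fun g => dVar (sId C f g) (fun p => dVar (sId C f g) (fun q =>
      dVar (sPwEq A B f g p q) (fun l =>
        let happ p := sLam (fun z => sHapp B p z) in
        (* A path is recovered from its pointwise form by [sFE]; for reflexivity this is [sFErefl].
           So [p] and [q] can be compared through their pointwise forms. *)
        let FE_happ p :=
          sJ p (fun f g p => sId (sId C f g) (sFE A B f g (sLam (fun z => sHapp B p z))) p)
               (fun f => sFErefl A B f) in
        dDef (sId (sId C f g) p q)
          (sTrans (sId C f g) q (sSym (sId C f g) (FE_happ p))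
            (sTrans (sId C f g) q
               (sMeta (i + 1) [sVar f; sVar g; happ p; happ q; sVar l]) (FE_happ q)))))))) ].

(* The last declaration: [FE h] is pointwise equal to [h], up to eta-expansion of
   the endpoints. *)
Definition FE_beta_decls (i : nat) (A B : stm) : list decl :=
  let C := sArr A B in
  let eta f := sFun A (fun _ => B) (fun z => sApp f z) in
  let H (f g : stm) := sPi A (fun z => sId B (sApp f z) (sApp g z)) in
  let tele (c : nat -> nat -> nat -> decl) :=
    dVar C (fun f => dVar C (fun g => dVar (H f g) (fun h => c f g h))) in
  (* Homotopy induction starts at a lambda-abstraction. With [eta f] as left endpoint the base case
     has equal endpoints, as [sFErefl] demands. *)
  let Q (f : stm) (g h : stm) :=
    sPi A (fun z => sId (sId B (sApp f z) (sApp g z)) (sHapp B (sFE A B (eta f) g h) z)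
                        (sApp h z)) in
  [ tele (fun f g h =>
      dPath A (fun _ => B) (fun z => sApp f z) (fun z => sApp g z) (fun z => sApp h z));
    tele (fun f g h =>
      dDef (Q f (eta g) (sFun A (fun z => sId B (sApp f z) (sApp g z)) (fun z => sApp h z)))
        (sHind A (fun _ => B) (fun z => sApp f z) (sMeta i [sVar f; sVar g; sVar h]) (Q f)
          (sAnn
             (sLam (fun z =>
                sAp (sId B (sApp f z) (sApp f z)) (fun p => sHapp B p z) (sFErefl A B (eta f))))
             (Q f (eta f) (sFun A (fun z => sId B (sApp f z) (sApp f z)) (fun _ => sRefl)))))) ].

(* The arguments of [sMeta] in the modules below are positions in the signature
   made of [base] and the declarations that follow it. *)
Module Poly.
Definition A : stm := sMeta 0 [].
Definition B (x : stm) : stm := sMeta 1 [x].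
Definition W : stm := sMeta 2 [].
Definition PX (C : stm) : stm := sSig A (fun x => sArr (B x) C).
Definition sPmap (C D g : stm) : stm :=
  sAnn (sLam (fun z => sSplit z (fun _ => PX D)
          (fun x v => sPair x (sLam (fun y => sApp g (sApp v y))))))
       (sArr (PX C) (PX D)).
Definition sHomEq (C sC D sD g : stm) : stm :=
  sId (sArr (PX C) D) (sLam (fun z => sApp g (sApp sC z)))
    (sLam (fun z => sApp sD (sApp (sPmap C D g) z))).
Definition sHom (C sC D sD : stm) : stm :=
  sSig (sArr C D) (fun g => sHomEq C sC D sD g).
Definition sContr (X : stm) : stm := sSig X (fun x => sPi X (fun y => sId X x y)).
End Poly.

(** * From W-types to initial algebras *)

Module Fwd.
Import Poly.
Definition sup (x t : stm) : stm := sMeta 3 [x; t].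
Definition D : stm := sMeta 4 [].
Definition sD : stm := sMeta 5 [].
Definition r (w : stm) : stm := sMeta 6 [w].
Definition q (x u : stm) : stm := sMeta 7 [x; u].
Definition p : stm := sMeta 8 [].
Definition e (w : stm) : stm := sMeta 9 [w].
Definition e_comp (x u : stm) : stm := sMeta 10 [x; u].

Definition sW : stm :=
  sAnn (sLam (fun z => sSplit z (fun _ => W) (fun x u => sup x u))) (sArr (PX W) W).
Definition Hom := sHom W sW D sD.
Definition HomEq := sHomEq W sW D sD.
Definition mkD (x n : stm) : stm := sApp sD (sPair x n).
Definition WB (x : stm) := sArr (B x) W.
Definition DB (x : stm) := sArr (B x) D.

Definition base : list decl :=
  [ dType; dVar A (fun _ => dType); dType;
    dVar A (fun x => dVar (WB x) (fun _ => dTerm W));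
    dType; dTerm (sArr (PX D) D) ].
Definition sW_decl : decl := dDef (sArr (PX W) W) sW.
Definition c1 : decl :=
  dVar A (fun x => dVar (WB x) (fun u => dVar (sPi (B x) (fun _ => D)) (fun v =>
    dDef D (mkD x v)))).
Definition rq : list decl :=
  [ dVar W (fun w => dTerm D);
    dVar A (fun x => dVar (WB x) (fun u =>
      dTerm (sId D (r (sup x u)) (mkD x (sLam (fun y => r (sApp u y))))))) ].
Definition f : stm := sAnn (sLam (fun w => r w)) (sArr W D).
Definition dp : list decl :=
  [ dDef (HomEq f)
      (sExt (PX W) D (sLam (fun z => sApp f (sApp sW z)))
         (sLam (fun z => sApp sD (sApp (sPmap W D f) z)))
         (sLam (fun z => sSplit z
            (fun z => sId D (sApp f (sApp sW z)) (sApp sD (sApp (sPmap W D f) z)))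
            (fun x u => q x u)))) ].
Definition at_sup (g x u : stm) : stm := sHapp D g (sPairAt x u A (fun x => WB x)).
(** The path at [sup x u] induced by a homotopy on the subtrees. It uses [p] at the pair and not
    [q x u], because extensionality does not compute: at the constant homotopy it is then [p]
    followed by the inverse of [gam], up to [sFErefl], which allows [p] and [gam] to be compared. *)
Definition coh (g x u h gam : stm) : stm :=
  let m := sAnn (sLam (fun y => r (sApp u y))) (DB x) in
  let n := sAnn (sLam (fun y => sApp g (sApp u y))) (DB x) in
  let d := sApp g (sup x u) in
  sTrans D d (at_sup p x u)
    (sTrans D d (sAp D (fun n => mkD x n) (sFE (B x) D m n h)) (sSym D (at_sup gam x u))).
(** Quantifying over [g] and [gam] inside the family lets one elimination serve all homomorphisms,
    as the contraction must be a single term. *)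
Definition CT (w : stm) : stm :=
  sPi (sArr W D) (fun g => sPi (HomEq g) (fun gam => sId D (r w) (sApp g w))).
Definition c2 : decl :=
  dVar A (fun x => dVar (WB x) (fun u => dVar (sPi (B x) (fun y => CT (sApp u y))) (fun v =>
    dDef (CT (sup x u))
      (sLam (fun g => sLam (fun gam =>
         coh g x u (sLam (fun y => sApp (sApp (sApp v y) g) gam)) gam)))))).
Definition eeq : list decl :=
  [ dVar W (fun w => dTerm (CT w));
    dVar A (fun x => dVar (WB x) (fun u =>
      let v := sFun (B x) (fun y => CT (sApp u y)) (fun y => e (sApp u y)) in
      dTerm (sId (CT (sup x u)) (e (sup x u))
        (sLam (fun g => sLam (fun gam =>
          coh g x u (sLam (fun y => sApp (sApp (sApp v y) g) gam)) gam)))))) ].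
Definition fp : stm := sAnn (sPair f p) Hom.
(* [refl ~ p . q^-1] gives [p ~ q] *)
Definition cancel (p q c : stm) : stm :=
  sApp (sApp (sJ q
    (fun d d' q => sPi (sId D d d') (fun p =>
       sArr (sId (sId D d d) sRefl (sTrans D d p (sSym D q))) (sId (sId D d d') p q)))
    (fun d => sLam (fun p => sLam (fun c =>
       sTrans (sId D d d) sRefl
         (sJ p (fun x y p => sId (sId D x y) p (sTrans D y p (sAnn sRefl (sId D y y))))
               (fun x => sRefl))
         (sSym (sId D d d) c))))) p) c.
Definition goal_at (g gam : stm) := sId Hom fp (sPairAt g gam (sArr W D) (fun g => HomEq g)).
(** The computation rule of the second elimination read at fixed [g] and [gam]: it makes [h] a
    2-cell between the homomorphisms [(f, p)] and [(g, gam)]. *)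
Definition cohT (g h gam : stm) : stm :=
  sPi A (fun x => sPi (WB x) (fun u =>
    sId (sId D (r (sup x u)) (sApp g (sup x u))) (sApp h (sup x u))
      (coh g x u (sLam (fun y => sApp h (sApp u y))) gam))).
Definition Q (g h : stm) : stm :=
  sPi (HomEq g) (fun gam => sArr (cohT g h gam) (goal_at g gam)).
Definition C : stm := sArr (PX W) D.
Definition path_eq (f g p q h : stm) : stm := sMeta 13 [f; g; p; q; h].
Definition pw := sPwEq (PX W) D.
Definition Lf : stm := sAnn (sLam (fun z => sApp f (sApp sW z))) C.
Definition Rf : stm := sAnn (sLam (fun z => sApp sD (sApp (sPmap W D f) z))) C.
Definition refls : stm := sFun W (fun w => sId D (r w) (r w)) (fun _ => sRefl).
(** At the constant homotopy, coherence equates reflexivity with [p], then an [sFE] at reflexivity,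
    then the inverse of [gam]. [sFErefl] removes the middle path and [cancel] does the rest. *)
Definition happ_eq_decl : decl :=
  dVar (HomEq f) (fun gam => dVar (cohT f refls gam) (fun c =>
    dDef (pw Lf Rf p gam)
      (sLam (fun z => sSplit z
        (fun z => sId (sId D (sApp Lf z) (sApp Rf z)) (sHapp D p z) (sHapp D gam z))
        (fun x u =>
           let d := sApp f (sup x u) in
           cancel (at_sup p x u) (at_sup gam x u)
             (sTrans (sId D d d) (sTrans D d (at_sup p x u) (sSym D (at_sup gam x u)))
                (sApp (sApp c x) u)
                (sAp (sId D d d)
                  (fun s => sTrans D d (at_sup p x u)
                      (sTrans D d (sAp D (fun n => mkD x n) s) (sSym D (at_sup gam x u))))
                  (sFErefl (B x) D (sFun (B x) (fun _ => D) (fun y => r (sApp u y))))))))))).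
Definition base_case : decl :=
  dDef (Q f refls)
    (sLam (fun gam => sLam (fun c =>
      sAp Hom (fun m => sPairAt f m (sArr W D) (fun g => HomEq g))
        (path_eq Lf Rf p gam (sMeta 14 [sVar gam; sVar c]))))).
Definition eta (g : stm) : stm := sFun W (fun _ => D) (fun w => sApp g w).
Definition htpy (g : stm) : stm := sPi W (fun w => sId D (r w) (sApp g w)).
Definition induction_decls : list decl :=
  [ dVar (sArr W D) (fun g => dVar (htpy g) (fun h =>
      dPath W (fun _ => D) (fun w => r w) (fun w => sApp g w) (fun w => sApp h w)));
    dVar (sArr W D) (fun g => dVar (htpy g) (fun h =>
      dDef (Q (eta g) (sFun W (fun w => sId D (r w) (sApp g w)) (fun w => sApp h w)))
        (sHind W (fun _ => D) r (sMeta 16 [sVar g; sVar h]) Q (sMeta 15 [])))) ].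
(* [HomEq g] and [HomEq (eta g)] agree definitionally since [g] only occurs applied. *)
Definition at_eta : decl :=
  dVar (sArr W D) (fun g =>
    dDef (sPi (HomEq (eta g)) (fun gam => goal_at (eta g) gam))
      (sLam (fun gam =>
         sApp (sApp (sMeta 17 [sVar g; sLam (fun w => sApp (sApp (e w) g) gam)]) gam)
           (sLam (fun x => sLam (fun u =>
              let P := sId D (r (sup x u)) (sApp g (sup x u)) in
              sHapp P (sHapp (sPi (HomEq g) (fun _ => P)) (e_comp x u) g) gam)))))).
(** [at_eta] treats homomorphisms carried by [eta g]; the inverse of [sEta] moves the statement,
    quantified over [gam], to an arbitrary [g]. *)
Definition final : decl :=
  dDef (sContr Hom)
    (sPair (sPair f p)
      (sLam (fun z => sSplit z (fun z => sId Hom fp z)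
        (fun g gam => sApp
           (sTr (fun g => sPi (HomEq g) (fun gam => goal_at g gam))
             (sSym (sArr W D) (sEta W D g)) (sMeta 18 [sVar g])) gam)))).
Definition script : list decl :=
  path_eq_decls 11 (PX W) D ++ [happ_eq_decl; base_case] ++ induction_decls ++ [at_eta; final].
End Fwd.

Section Forward.
Variables (ax : ctx -> judgement -> Prop) (G : ctx) (A B W sup : tm).
Hypotheses (hA : G |-{ax} IsType A) (hB : A :: G |-{ax} IsType B)
  (hW : G |-{ax} IsType W) (hsup : W_ctx G A B W |-{ax} HasType sup W.[shift 2]).

Let HG : G |-{ax} IsCtx := der_ctx _ _ _ hA.

Lemma alg_of_sup_type : G |-{ax} HasType (alg_of_sup sup) (arr (P A B W) W).
Proof.
  assert (HM := model_nil ax G).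
  add_type HG (decl_at Fwd.base 0) A HM; [|der_by hA].
  add_type HG (decl_at Fwd.base 1) B HM; [|der_by hB].
  add_type HG (decl_at Fwd.base 2) W HM; [|der_by hW].
  add_term HG (decl_at Fwd.base 3) sup HM; [|der_by hsup].
  assert (h := def_sound ax G HG _ _ Fwd.sW_decl _ _ _ HM ltac:(vm_compute; reflexivity)).
  der_by h.
Qed.

Lemma W_initial D sD :
  W_elim_comp ax G A B W sup -> is_alg ax G A B D sD ->
  inhabited ax G (contr (Alg_hom A B W (alg_of_sup sup) D sD)).
Proof.
  intros helim hD.
  assert (hD1 : W :: G |-{ax} IsType D.[shift 1]) by exact (der_wk ax G W _ hW (proj1 hD)).
  assert (HM := model_nil ax G).
  add_type HG (decl_at Fwd.base 0) A HM; [|der_by hA].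
  add_type HG (decl_at Fwd.base 1) B HM; [|der_by hB].
  add_type HG (decl_at Fwd.base 2) W HM; [|der_by hW].
  add_term HG (decl_at Fwd.base 3) sup HM; [|der_by hsup].
  add_type HG (decl_at Fwd.base 4) D HM; [|der_by (proj1 hD)].
  add_term HG (decl_at Fwd.base 5) sD HM; [|der_by (proj2 hD)].
  assert (hc := def_sound ax G HG _ _ Fwd.c1 _ _ _ HM ltac:(vm_compute; reflexivity)).
  cbn in hc.
  (* First elimination, into the constant family [D]: the recursor and its computation path. *)
  edestruct (helim D.[shift 1]) as (r & hr & q & hq); [exact hD1 | der_by hc |].
  add_term HG (decl_at Fwd.rq 0) r HM; [|der_by hr].
  add_term HG (decl_at Fwd.rq 1) q HM; [|der_by hq].
  eapply (model_def ax G HG _ _ (decl_at Fwd.dp 0)) in HM; [|vm_compute; reflexivity].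
  destruct HM as [p HM].
  assert (hc2 := def_sound ax G HG _ _ Fwd.c2 _ _ _ HM ltac:(vm_compute; reflexivity)).
  cbn in hc2.
  (* The second elimination needs [CT] to be a type; this is read off the check of the declaration
     of [e], before [e] exists. *)
  match goal with HM : model _ _ ?Ms ?Sg |- _ =>
    assert (hC := entry_sound ax G HG _ _ (decl_at Fwd.eeq 0) _ _ HM ltac:(vm_compute; reflexivity)) end.
  destruct hC as (_ & hC & _). specialize (hC _ eq_refl).
  apply wf_type_der in hC. cbn in hC.
rewrite (subst_shift0 W) in hC.
  edestruct helim as (e & he & eq & heq); [exact hC | der_by hc2 |].
  add_term HG (decl_at Fwd.eeq 0) e HM; [|der_by he].
  add_term HG (decl_at Fwd.eeq 1) eq HM; [|der_by heq].
  destruct (run_last ax G HG true Fwd.script _ _ _ _ (fun _ => homotopy_path ax) HM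
              ltac:(vm_compute; reflexivity)) as (Ns & t & Ht).
  exists t. der_by Ht.
Qed.
End Forward.

(** * From initial algebras to W-types *)

Module Bwd.
Import Poly.
Definition sW : stm := sMeta 3 [].
Definition C (w : stm) : stm := sMeta 4 [w].
Definition c (x u v : stm) : stm := sMeta 5 [x; u; v].
Definition hD : stm := sMeta 6 [].
Definition hW : stm := sMeta 7 [].
Definition R : stm := sMeta 8 [].

Definition WB (x : stm) := sArr (B x) W.
Definition mkW (x n : stm) : stm := sApp sW (sPair x n).
Definition D : stm := sSig W (fun w => C w).
Definition sD : stm :=
  sAnn (sLam (fun z => sSplit z (fun _ => D) (fun x u =>
    let u1 := sFun (B x) (fun _ => W) (fun y => sP1 (sApp u y)) in
    sPair (mkW x u1) (c x u1 (sLam (fun y => sP2 (sApp u y)))))))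
  (sArr (PX D) D).
Definition HomEqD := sHomEq W sW D sD.
Definition HomEqW := sHomEq W sW W sW.
Definition HomD := sHom W sW D sD.
Definition HomW := sHom W sW W sW.

Definition base : list decl :=
  [ dType; dVar A (fun _ => dType); dType; dTerm (sArr (PX W) W);
    dVar W (fun _ => dType);
    dVar A (fun x => dVar (WB x) (fun u => dVar (sPi (B x) (fun y => C (sApp u y))) (fun v =>
      dTerm (C (mkW x u))))) ].
Definition sup_decl : decl := dVar A (fun x => dVar (WB x) (fun u => dDef W (mkW x u))).
Definition D_decl : decl := dTerm D.
Definition sD_decl : decl := dDef (sArr (PX D) D) sD.
Definition contr_decls : list decl := [ dTerm (sContr HomD); dTerm (sContr HomW) ].

Definition pr (x u : stm) : stm := sPairAt x u A (fun x => WB x).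
Definition L (g : stm) : stm := sFun (PX W) (fun _ => W) (fun z => sApp g (sApp sW z)).
Definition Rt (g : stm) : stm :=
  sFun (PX W) (fun _ => W) (fun z => sApp sW (sApp (sPmap W W g) z)).
(* [T g gam]: a section of [C o g] commuting with the structure maps over [gam]. *)
Definition T (g gam : stm) : stm :=
  sSig (sPi W (fun w => C (sApp g w))) (fun r =>
    sPi A (fun x => sPi (WB x) (fun u =>
      let gu := sFun (B x) (fun _ => W) (fun y => sApp g (sApp u y)) in
      sId (C (mkW x gu)) (sTr C (sHapp W gam (pr x u)) (sApp r (mkW x u)))
        (c x gu (sLam (fun y => sApp r (sApp u y))))))).

Definition htpy (g : stm) (z : stm) : stm := sId W (sApp (L g) z) (sApp (Rt g) z).
Definition by_cases (g : stm) (k : stm -> stm -> stm) : stm :=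
  sFun (PX W) (htpy g) (fun z => sSplit z (fun z => htpy g z) (fun x u => k x u)).
Definition glue (g : stm) (k : stm -> stm -> stm) : stm :=
  sFE (PX W) W (L g) (Rt g) (by_cases g k).
(* [i]: index of the second of [FE_beta_decls] *)
Definition glue_beta (i : nat) (g : stm) (k : stm -> stm -> stm) (x u : stm) : stm :=
  sApp (sMeta i [L g; Rt g; by_cases g k]) (pr x u).

Definition proj (f : stm) : stm := sFun W (fun _ => W) (fun w => sP1 (sApp f w)).
(** The first component of [sD] is the structure map of [W], so projecting the structure path of [f]
    makes [proj f] an endomorphism of the algebra [W]. *)
Definition projk (p : stm) (x u : stm) : stm := sAp W (fun d => sP1 d) (sHapp D p (pr x u)).
(** [glue_beta] replaces the value of the glued path by the projected one; along that path the
    second projections are compatible by J on the structure path of [f] at the pair. *)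
Definition t_decl : decl :=
  dVar (sArr W D) (fun f => dVar (HomEqD f) (fun p =>
    let g := proj f in
    dDef (T g (glue g (projk p)))
      (sPair (sLam (fun w => sP2 (sApp f w)))
        (sLam (fun x => sLam (fun u =>
          let v := sP2 (sApp f (mkW x u)) in
          let gu := sFun (B x) (fun _ => W) (fun y => sApp g (sApp u y)) in
          let cc := c x gu (sLam (fun y => sP2 (sApp f (sApp u y)))) in
          sTrans (C (mkW x gu)) cc
            (sAp (C (mkW x gu)) (fun m => sTr C m v) (glue_beta 9 g (projk p) x u))
            (sJ (sHapp D p (pr x u))
              (fun d d' m => sId (C (sP1 d')) (sTr C (sAp W (fun d => sP1 d) m) (sP2 d)) (sP2 d'))
              (fun d => sRefl)))))))).
Definition idW : stm := sFun W (fun _ => W) (fun w => w).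
(** [idW] composed with [u] is an abstraction and not [u] itself, so the structure path of the
    identity comes from the eta path of [u]. *)
Definition idk (x u : stm) : stm := sAp W (fun n => mkW x n) (sEta (B x) W u).
Definition R_type : stm := T idW (glue idW idk).
Definition R_decls : list decl :=
  let hom g gam := sPairAt g gam (sArr W W) (fun g => HomEqW g) in
  [ dVar (sArr W D) (fun f => dVar (HomEqD f) (fun p =>
      let z0 := hom (proj f) (glue (proj f) (projk p)) in
      let z1 := hom idW (glue idW idk) in
      dDef R_type
        (sTr (fun z => T (sP1 z) (sP2 z))
          (* The two endomorphisms are joined through the centre of [HomW]. *)
          (sTrans HomW z1 (sSym HomW (sApp (sP2 hW) z0)) (sApp (sP2 hW) z1))
          (sMeta 10 [sVar f; sVar p]))));
    dDef R_type (sMeta 11 [sP1 (sP1 hD); sP2 (sP1 hD)]) ].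
Definition script1 : list decl := FE_beta_decls 8 (PX W) W ++ t_decl :: R_decls.

Definition r (w : stm) : stm := sApp (sP1 R) w.
Definition q_type (x u : stm) : stm :=
  sId (C (mkW x u)) (r (mkW x u)) (c x u (sLam (fun y => r (sApp u y)))).
Definition r_decl : decl := dVar W (fun w => dDef (C w) (r w)).
(* At an eta-expanded [u'] the path [idk x u'] is refl, because [FE] is normalised. *)
Definition eta_decl : decl :=
  dVar A (fun x => dVar (WB x) (fun u =>
    let u' := sFun (B x) (fun _ => W) (fun y => sApp u y) in
    let w := mkW x u' in
    dDef (q_type x u')
      (sTrans (C w) (c x u' (sLam (fun y => r (sApp u' y))))
        (sSym (C w)
          (sAp (C w) (fun m => sTr C m (r w))
            (sTrans (sId W w w) (sAnn sRefl (sId W w w))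
              (glue_beta 10 idW idk x u')
              (sAp (sId W w w) (fun s => sAp W (fun n => mkW x n) s)
                (sFErefl (B x) W u')))))
        (sApp (sApp (sP2 R) x) u')))).
(** [eta_decl] covers abstractions; transporting all of [q_type] along the eta path reaches an
    arbitrary [u]. *)
Definition q_decl : decl :=
  dVar A (fun x => dVar (WB x) (fun u =>
    dDef (q_type x u)
      (sTr (fun u => q_type x u) (sSym (WB x) (sEta (B x) W u)) (sMeta 11 [sVar x; sVar u])))).
(** Only the last realiser, [R], is kept from [script1], as symbol 8; the declarations behind
    [glue_beta] are run again from index 9. *)
Definition script2 : list decl := FE_beta_decls 9 (PX W) W ++ [eta_decl; q_decl].
End Bwd.

Section Backward.
Variables (ax : ctx -> judgement -> Prop) (G : ctx) (A B W sW : tm).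
Hypotheses (hA : G |-{ax} IsType A) (hB : A :: G |-{ax} IsType B)
  (hW : is_alg ax G A B W sW)
  (hinit : forall D sD, is_alg ax G A B D sD ->
     inhabited ax G (contr (Alg_hom A B W sW D sD))).

Let HG : G |-{ax} IsCtx := der_ctx _ _ _ hA.

Lemma sup_of_alg_type :
  W_ctx G A B W |-{ax} HasType (sup_of_alg sW) W.[shift 2].
Proof.
  assert (HM := model_nil ax G).
  add_type HG (decl_at Bwd.base 0) A HM; [|der_by hA].
  add_type HG (decl_at Bwd.base 1) B HM; [|der_by hB].
  add_type HG (decl_at Bwd.base 2) W HM; [|der_by (proj1 hW)].
  add_term HG (decl_at Bwd.base 3) sW HM; [|der_by (proj2 hW)].
  assert (h := def_sound ax G HG _ _ Bwd.sup_decl _ _ _ HM ltac:(vm_compute; reflexivity)).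
  der_by h.
Qed.

Lemma initial_elim : W_elim_comp ax G A B W (sup_of_alg sW).
Proof.
  intros C c hC hc.
  assert (HM := model_nil ax G).
  add_type HG (decl_at Bwd.base 0) A HM; [|der_by hA].
  add_type HG (decl_at Bwd.base 1) B HM; [|der_by hB].
  add_type HG (decl_at Bwd.base 2) W HM; [|der_by (proj1 hW)].
  add_term HG (decl_at Bwd.base 3) sW HM; [|der_by (proj2 hW)].
  add_type HG (decl_at Bwd.base 4) C HM; [|der_by hC].
  add_term HG (decl_at Bwd.base 5) c HM; [|der_by hc].
  assert (hD : G |-{ax} IsType (Sig W C)).
  { destruct (entry_sound ax G HG _ _ Bwd.D_decl _ _ HM ltac:(vm_compute; reflexivity))
      as (_ & h & _).
    specialize (h _ eq_refl). apply wf_type_der in h. der_by h. }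
  assert (hsD := def_sound ax G HG _ _ Bwd.sD_decl _ _ _ HM ltac:(vm_compute; reflexivity)).
  edestruct (hinit (Sig W C)) as (k & hk); [split; [exact hD | der_by hsD] |].
  add_term HG (decl_at Bwd.contr_decls 0) k HM; [|der_by hk].
  (* Initiality with target [W] itself will identify the projected endomorphism with the
     identity. *)
  destruct (hinit W sW hW) as (k' & hk').
  add_term HG (decl_at Bwd.contr_decls 1) k' HM; [|der_by hk'].
  destruct (run_last ax G HG true Bwd.script1 _ _ _ _ (fun _ => homotopy_path ax) HM
              ltac:(vm_compute; reflexivity)) as (Ns & R & hR).
  (* From here [R] is an abstract symbol, from which both the recursor and its computation path are
     read off. *)
  add_term HG (dTerm Bwd.R_type) R HM; [|der_by hR].
  assert (hr := def_sound ax G HG _ _ Bwd.r_decl _ _ _ HM ltac:(vm_compute; reflexivity)).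
  destruct (run_last ax G HG true Bwd.script2 _ _ _ _ (fun _ => homotopy_path ax) HM
              ltac:(vm_compute; reflexivity)) as (Ns' & q & hq).
  eexists; split; [der_by hr|].
  exists q. der_by hq.
Qed.
End Backward.

(** * Weakening of the data and the equivalence *)

Section Weakening.
Variables (ax : ctx -> judgement -> Prop) (G E : ctx) (A B : tm).
Hypotheses (hA : G |-{ax} IsType A) (hB : A :: G |-{ax} IsType B)
  (hE : E ++ G |-{ax} IsCtx).
Local Notation s := (shift (length E)).

Lemma weaken_type X : G |-{ax} IsType X -> E ++ G |-{ax} IsType X.[s].
Proof.
  intros HX; exact (d_subst ax G (E ++ G) s _ HX hE (typed_shift ax E G hE)).
Qed.

Lemma weaken_family : A.[s] :: E ++ G |-{ax} IsType B.[up s].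
Proof.
  refine (d_subst ax (A :: G) _ (up s) _ hB _ _).
  - apply d_cons, weaken_type, hA.
  - apply typed_up; [now apply typed_shift | now apply weaken_type].
Qed.

Lemma weaken_sup W sup :
  W_ctx G A B W |-{ax} HasType sup W.[shift 2] ->
  W_ctx (E ++ G) A.[s] B.[up s] W.[s] |-{ax} HasType sup.[up (up s)] W.[s].[shift 2].
Proof.
  intros H. assert (HW := ctx_inv _ _ _ (der_ctx _ _ _ H)).
  assert (T1 := typed_up ax _ _ _ _ (typed_shift ax E G hE) (weaken_type _ hA)).
  assert (HW' := d_subst ax _ _ _ _ HW (d_cons _ _ _ (weaken_type _ hA)) T1).
  assert (T2 := typed_up ax _ _ _ (arr B W.[shift 1]) T1 HW').
  der_by (d_subst ax _ _ _ _ H (d_cons _ _ _ HW') T2).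
Qed.
End Weakening.

Lemma W_rules_initial ax G A B W sup :
  G |-{ax} IsType A -> A :: G |-{ax} IsType B ->
  W_rules ax G A B W sup -> homotopy_initial ax G A B W (alg_of_sup sup).
Proof.
  intros hA hB [hW hsup helim]. split.
  - split; [exact hW | now apply alg_of_sup_type].
  - intros E D sD s hE hD.
    (* The construction commutes with weakening, so [E ++ G] can take the place of [G]. *)
    replace (alg_of_sup sup).[s] with (alg_of_sup sup.[up (up s)]) by raw_eq.
    subst s; apply W_initial.
    + now apply weaken_type.
    + now apply weaken_family.
    + now apply weaken_type.
    + now apply weaken_sup.
    + now apply helim.
    + exact hD.
Qed.

Lemma initial_W_rules ax G A B W sW :
  G |-{ax} IsType A -> A :: G |-{ax} IsType B ->
  homotopy_initial ax G A B W sW -> W_rules ax G A B W (sup_of_alg sW).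
Proof.
  intros hA hB [hW hinit]. split.
  - apply hW.
  - now apply sup_of_alg_type.
  - intros E s hE.
    replace (sup_of_alg sW).[up (up s)] with (sup_of_alg sW.[s]) by raw_eq.
    subst s; apply initial_elim.
    + now apply weaken_type.
    + now apply weaken_family.
    + split; [now apply weaken_type, hW|].
      der_by (d_subst ax _ _ _ _ (proj2 hW) hE (typed_shift ax E G hE)).
    + intros D sD; now apply hinit.
Qed.

Theorem theorem3p7 (ax : ctx -> judgement -> Prop) (G : ctx) (A B : tm)
  (hA : G |-{ax} IsType A)
  (hB : A :: G |-{ax} IsType B) :
  ((exists W sup, W_rules ax G A B W sup) <->
   (exists W sW, homotopy_initial ax G A B W sW)) /\
  (forall W sup, W_rules ax G A B W sup ->
     homotopy_initial ax G A B W (alg_of_sup sup)) /\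
  (forall W sW, homotopy_initial ax G A B W sW ->
     W_rules ax G A B W (sup_of_alg sW)).
Proof.
  split; [split|split].
  - intros (W & sup & H). exists W, (alg_of_sup sup). now apply W_rules_initial.
  - intros (W & sW & H). exists W, (sup_of_alg sW). now apply initial_W_rules.
  - intros W sup; now apply W_rules_initial.
  - intros W sW; now apply initial_W_rules.
Qed.
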